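(* Let $\mathcal{C}$ be a binary linear block code of rate $R$ whose transmission, with equiprobable codewords, takes place over a memoryless binary-input output-symmetric (MBIOS) channel with capacity $C$ (in bits per channel use). For an arbitrary full-rank parity-check matrix $H$ of $\mathcal{C}$, let $\Gamma_k$ designate the fraction of parity-check equations (rows of $H$) that involve exactly $k$ variables, and let $\Gamma(x)=\sum_k\Gamma_k x^k$. Then, under maximum-likelihood decoding (or any other decoding algorithm), the bit error probability $P_{\mathrm b}$ of the code satisfies $$h_2(P_{\mathrm b}) \;\geq\; 1 - \frac{C}{R} + \frac{1-R}{2R\ln 2} \sum_{p=1}^{\infty} \frac{\Gamma(g_p)}{p(2p-1)},$$ where $h_2(x)=-x\log_2 x-(1-x)\log_2(1-x)$ is the binary entropy function to base 2, $$g_p = \int_0^{\infty} a(l)\,(1+e^{-l})\, \tanh^{2p}\!\left(\frac{l}{2}\right) dl, \qquad p \in \mathbb{N}=\{1,2,\dots\},$$ and $a$ is the conditional pdf of the log-likelihood ratio at the channel output given that the channel input is $+1$.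
   Context: An MBIOS channel is a memoryless channel with input alphabet $\{+1,-1\}$ and transition law $p_{Y|X}$ that is output-symmetric: $p_{Y|X}(y\mid 1)=p_{Y|X}(-y\mid -1)$ (real output $y$; in general, there is a measurable involution of the output alphabet playing the role of $y\mapsto -y$). Code bits $0,1$ are mapped to the inputs $+1,-1$ respectively. The log-likelihood ratio (LLR) of an output $y$ is $l=\ln\frac{p_{Y|X}(y\mid 1)}{p_{Y|X}(y\mid -1)}$. The ''pdf'' $a$ of the LLR given input $+1$ is understood in the generalized sense: the law of the LLR may contain point masses, including a point mass at $+\infty$ (e.g. for the binary erasure channel), and the integral defining $g_p$ then includes the contribution of that mass with the conventions $e^{-\infty}=0$, $\tanh(\infty)=1$. By channel symmetry, $a(-l)=e^{-l}a(l)$ for $l \ge 0$. The rate is $R=\dim(\mathcal{C})/n>0$, where $n$ is the block length; a full-rank parity-check matrix of $\mathcal{C}$ has exactly $n(1-R)$ rows, linearly independent over $GF(2)$. The capacity $C$ is the mutual information between a uniform input on $\{+1,-1\}$ and the channel output, in bits. Bit error probability: the codewords are the images of uniformly distributed vectors of $nR$ information bits under a linear bijective encoder, and $P_{\mathrm b}$ is the average, over the $nR$ information bits, of the probability that the decoder's decision on that bit (a function of the whole received sequence) is wrong. The convention $0\log_2 0=0$ is used. *)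

(* Defs.v *)
From HB Require Import structures.
From mathcomp Require Import all_boot all_order all_algebra.
From mathcomp Require Import all_classical all_reals all_analysis.
From mathcomp Require Import measurable_realfun.

Set Implicit Arguments.
Unset Strict Implicit.
Unset Printing Implicit Defensive.

Import Order.TTheory GRing.Theory Num.Theory.
Import numFieldNormedType.Exports.

Local Open Scope classical_set_scope.
Local Open Scope ring_scope.

(* A channel input in {+1, -1} is represented by its sign bit s, standing for
   (-1) ^+ s: false is +1 and true is -1. *)
Definition input := bool.

(* [chan_law s] is the conditional law of the output given the input s and
   [chan_pdf s] is its density with respect to the reference measure
   [chan_ref] (Lebesgue measure for continuous outputs, counting measure for
   discrete ones; chan_law false + chan_law true is always possible).
   [chan_opp] plays the role of y |-> - y on the output alphabet. *)
Record mbios (d : measure_display) (Y : measurableType d) (R : realType) :=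
  Mbios {
    chan_law : input -> probability Y R ;
    chan_ref : {sigma_finite_measure set Y -> \bar R} ;
    chan_pdf : input -> Y -> R ;
    chan_pdf_ge0 : forall s y, 0 <= chan_pdf s y ;
    measurable_chan_pdf : forall s, measurable_fun [set: Y] (chan_pdf s) ;
    chan_lawE : forall s A, measurable A ->
      chan_law s A = (\int[chan_ref]_(y in A) (chan_pdf s y)%:E)%E ;
    chan_opp : Y -> Y ;
    measurable_chan_opp : measurable_fun [set: Y] chan_opp ;
    chan_oppK : involutive chan_opp ;
    chan_ref_opp : forall A, measurable A ->
      chan_ref (chan_opp @^-1` A) = chan_ref A ;
    chan_sym : forall y, chan_pdf false y = chan_pdf true (chan_opp y)
  }.

Section information.
Context (R : realType).
Implicit Types x : R.

Definition log2 x : R := ln x / ln 2.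

(* The library's [ln 0 = 0] realizes the convention 0 log2 0 = 0. *)
Definition h2 x : R := - x * log2 x - (1 - x) * log2 (1 - x).

Definition tanh x : R := (expR x - expR (- x)) / (expR x + expR (- x)).

Definition etanh (l : \bar R) : \bar R :=
  match l with
  | r%:E => (tanh r)%:E
  | +oo%E => 1%E
  | -oo%E => (-1)%E
  end.

End information.

Section channel.
Context (d : measure_display) (Y : measurableType d) (R : realType).
Variable W : mbios Y R.

(* I(X; Y) in bits for an input X of law q. The denominator is positive
   wherever q s and chan_pdf s y are; elsewhere the term is 0. *)
Definition mutual_information (q : input -> R) : R :=
  \sum_(s : input) q s *
    (\int[chan_ref W]_(y in [set: Y])
       (chan_pdf W s y *
        log2 (chan_pdf W s y / \sum_(t : input) q t * chan_pdf W t y)))%R.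

Definition capacity : R := mutual_information (fun=> 2^-1).

(* In the extended reals, r / 0 = +oo for r > 0 and lne 0 = -oo; 0 / 0 only
   occurs on a set that is null under both inputs. *)
Definition llr (y : Y) : \bar R :=
  lne ((chan_pdf W false y)%:E / (chan_pdf W true y)%:E)%E.

Lemma measurable_llr : measurable_fun [set: Y] llr.
Proof.
pose p := chan_pdf W false; pose q := chan_pdf W true.
have mp : measurable_fun [set: Y] p by exact: measurable_chan_pdf.
have mq : measurable_fun [set: Y] q by exact: measurable_chan_pdf.
have -> : llr = (fun y => if p y <= 0 then -oo%E else
    if q y <= 0 then +oo%E else (ln (p y) - ln (q y))%:E).
  apply/funext => y; rewrite /llr -/(p y) -/(q y).
  have p0 : 0 <= p y by exact: chan_pdf_ge0.
  have q0 : 0 <= q y by exact: chan_pdf_ge0.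
  rewrite inver; case: (leP (p y) 0) => [pn|pp].
    have -> : p y = 0 by apply/eqP; rewrite eq_le pn.
    by rewrite mul0e /= lexx.
  case: (leP (q y) 0) => [qn|qp].
    have -> : q y = 0 by apply/eqP; rewrite eq_le qn.
    by rewrite eqxx gt0_muley ?lte_fin.
  rewrite gt_eqF// -EFinM lne_EFin ?divr_gt0//.
  by rewrite ln_div ?posrE.
apply: measurable_fun_ifT => //.
  exact: measurable_fun_ler.
apply: measurable_fun_ifT => //.
  exact: measurable_fun_ler.
apply/measurable_EFinP; apply: measurable_funB.
  exact: (measurableT_comp (@measurable_ln R) mp).
exact: (measurableT_comp (@measurable_ln R) mq).
Qed.

HB.instance Definition _ := isMeasurableFun.Build _ _ _ _ llr measurable_llr.

(* The law a(l) dl of the LLR given the input +1, as a probability measure on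
   the extended reals: it accounts for point masses, including at +oo. *)
Definition llr_law : probability (\bar R) R := distribution (chan_law W false) llr.

Definition g_ (p : nat) : R :=
  fine (\int[llr_law]_(l in [set l | 0 <= l])
    ((1 + expeR (- l)) * etanh (l * 2^-1%:E) ^+ (2 * p)))%E.

End channel.

Section code.
Context (n : nat).

Definition rate (R : realType) (C : {vspace 'rV['F_2]_n}) : R :=
  (\dim C)%:R / n%:R.

Definition parity_check (C : {vspace 'rV['F_2]_n}) m (H : 'M['F_2]_(m, n)) :=
  forall c : 'rV['F_2]_n, (c \in C) = (H *m c^T == 0).

Definition row_degree m (H : 'M['F_2]_(m, n)) (i : 'I_m) : nat :=
  #|[pred j | H i j != 0]|.

Definition Gamma_coef (R : realType) m (H : 'M['F_2]_(m, n)) (k : nat) : R :=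
  #|[pred i | row_degree H i == k]|%:R / m%:R.

Definition Gamma (R : realType) m (H : 'M['F_2]_(m, n)) : {poly R} :=
  \poly_(k < n.+1) Gamma_coef R H k.

Definition encoder (C : {vspace 'rV['F_2]_n})
    (enc : 'Hom('rV['F_2]_(\dim C), 'rV['F_2]_n)) :=
  lker enc = 0%VS /\ limg enc = C.

End code.

Definition modulate (b : 'F_2) : input := b != 0.

(* [U] is a uniformly distributed vector of k information bits and [V] the
   sequence received when the codeword [enc U] is sent, bit by bit, over
   memoryless uses of the channel [W]. *)
Definition transmission (d d' : measure_display) (Omega : measurableType d')
    (Y : measurableType d) (R : realType) (P : probability Omega R)
    (W : mbios Y R) (n k : nat) (enc : 'rV['F_2]_k -> 'rV['F_2]_n)
    (U : Omega -> 'rV['F_2]_k) (V : Omega -> n.-tuple Y) :=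
  [/\ forall u, measurable [set w | U w = u],
      forall u, P [set w | U w = u] = ((2 ^+ k)^-1)%:E,
      measurable_fun [set: Omega] V &
      forall u (A : 'I_n -> set Y), (forall j, measurable (A j)) ->
        P ([set w | U w = u] `&` [set w | forall j, A j (tnth (V w) j)]) =
        (P [set w | U w = u] *
         \prod_(j < n) chan_law W (modulate (enc u 0%R j)) (A j))%E].

(* A decoder decides on each information bit from the whole received
   sequence. *)
Definition measurable_decoder (d : measure_display) (Y : measurableType d)
    (n k : nat) (dec : 'I_k -> n.-tuple Y -> 'F_2) :=
  forall i b, measurable [set v | dec i v = b].

Definition bit_error_probability (d d' : measure_display)
    (Omega : measurableType d') (Y : measurableType d) (R : realType)
    (P : probability Omega R) (n k : nat) (U : Omega -> 'rV['F_2]_k)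
    (V : Omega -> n.-tuple Y) (dec : 'I_k -> n.-tuple Y -> 'F_2) : R :=
  (\sum_(i < k) fine (P [set w | dec i (V w) != U w 0 i])) / k%:R.

(* Main.v *)
Require Import Defs.
From HB Require Import structures.
From mathcomp Require Import all_boot all_order all_algebra.
From mathcomp Require Import all_classical all_reals all_analysis.
From mathcomp Require Import measurable_realfun.
From mathcomp Require Import ring lra.

Set Implicit Arguments.
Unset Strict Implicit.
Unset Printing Implicit Defensive.

Import Order.TTheory GRing.Theory Num.Theory.
Import numFieldNormedType.Exports.

Local Open Scope classical_set_scope.
Local Open Scope ring_scope.

(** Let Q be the law of the output sequence when all inputs are independent and
    uniform, t_j the conditional mean of the j-th sign given the j-th output,
    and T_i the product of the t_j over the support of the i-th check. Given the
    information vector u, the output sequence has the Q-density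
    L_u = prod_j (1 + x_j t_j), where x is the modulated codeword. Gibbs'
    inequality compares the joint law of information and output with the product
    of a guess of the information (each decided bit is right with probability
    1 - eps, independently) and the output density prod_i (1 + lam T_i), which
    accounts for the checks; the latter has Q-mean 1 because the checks are
    independent and the odd moments of t_j vanish. A codeword satisfies its
    checks, so E[L_u T_i^(2p-1)] = E[L_u T_i^(2p)] = g_p^(degree of i), and
    ln (1 + lam T_i) averages to the series of the theorem as lam tends to 1. The
    guess contributes h2(Pb) after optimizing eps, and the L_u contribute the
    capacity. *)

(** * Measures given by a density *)

Section density.
Context (d : measure_display) (T : measurableType d) (R : realType).
Variables (mu : {measure set T -> \bar R}) (f : T -> R).
Hypotheses (mf : measurable_fun [set: T] f) (f_ge0 : forall x, 0 <= f x).

(** The proofs of measurability and nonnegativity are arguments, so that the measure structure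
    declared below can be found from the term alone. *)
Definition density_measure of measurable_fun [set: T] f & forall x, 0 <= f x :=
  fun A : set T => (\int[mu]_(x in A) (f x)%:E)%E.

Local Notation mdensity := (density_measure mf f_ge0).

Let mEf : measurable_fun [set: T] (EFin \o f).
Proof. exact/measurable_EFinP. Qed.

Let mdensity0 : mdensity set0 = 0%E.
Proof. exact: integral_set0. Qed.

Let mdensity_ge0 A : (0 <= mdensity A)%E.
Proof. by apply: integral_ge0 => x _; rewrite lee_fin. Qed.

Let mdensity_sigma_additive : semi_sigma_additive mdensity.
Proof.
move=> F mF tF mUF; rewrite /density_measure ge0_integral_bigcup//.
- apply: is_cvg_ereal_nneg_natsum_cond => n _ _.
  by apply: integral_ge0 => x _; rewrite lee_fin.
- exact: measurable_funTS.
- by move=> x _; rewrite lee_fin.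
Qed.

HB.instance Definition _ := isMeasure.Build _ _ _ mdensity
  mdensity0 mdensity_ge0 mdensity_sigma_additive.

Import HBNNSimple.

(** Both sides are limits along the increasing simple approximations of [g], by monotone
    convergence; for an indicator the equality is the definition of the density measure. *)
Lemma ge0_integral_density_measure (g : T -> \bar R) :
  measurable_fun [set: T] g -> (forall x, 0 <= g x)%E ->
  (\int[mdensity]_x g x = \int[mu]_x (g x * (f x)%:E))%E.
Proof.
move=> mg g0.
pose g_ := nnsfun_approx measurableT mg.
(* Used with the density measure and [h = 1] for the left side, and with [mu] and [h = f] for the
   right side. *)
have gE (m : {measure set T -> \bar R}) (h : T -> R) :
    measurable_fun [set: T] h -> (forall x, 0 <= h x) ->
    (\int[m]_x (g x * (h x)%:E) =
     limn (fun n => \int[m]_x ((g_ n x)%:E * (h x)%:E)))%E.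
  move=> mh h0; rewrite -monotone_convergence//.
  - apply: eq_integral => x _; apply/esym/cvg_lim => //.
    by apply: cvgeZr => //; apply: cvg_nnsfun_approx => // ? _.
  - move=> n; apply: emeasurable_funM; apply/measurable_EFinP => //.
  - by move=> n x _; rewrite mule_ge0// lee_fin.
  - move=> x _ a b ab; rewrite lee_wpmul2r// lee_fin//.
    exact/lefP/nd_nnsfun_approx.
have := gE mdensity (cst 1) (measurable_cst _) (fun=> ler01).
under eq_integral do rewrite mule1.
move=> ->; rewrite gE//; congr (limn _); apply/funext => n.
under eq_integral do rewrite mule1.
have E x : ((g_ n x)%:E =
    \sum_(r \in range (g_ n)) (r * \1_(g_ n @^-1` [set r]) x)%:E)%E.
  by rewrite fimfunE -fsumEFin.
have E0 r x : (0 <= (r * \1_(g_ n @^-1` [set r]) x)%:E)%E.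
  by rewrite EFinM nnfun_muleindic_ge0.
under eq_integral do rewrite E.
have E' x : ((g_ n x)%:E * (f x)%:E = \sum_(r \in range (g_ n))
    ((r * \1_(g_ n @^-1` [set r]) x)%:E * (f x)%:E))%E.
  by rewrite E ge0_mule_fsuml.
under [RHS]eq_integral do rewrite E'.
have mE r : measurable_fun setT (fun x => (r * \1_(g_ n @^-1` [set r]) x)%:E).
  exact/measurable_EFinP/measurable_funM.
rewrite [LHS]ge0_integral_fsum// [RHS]ge0_integral_fsum//; last 2 first.
- by move=> r; exact: emeasurable_funM.
- by move=> r x _; rewrite mule_ge0// lee_fin.
(* The approximations are nonnegative, so a negative level [r] has an empty preimage and contributes
   0 on both sides. *)
apply: eq_fsbigr => r _; have [r0|r0] := ltP r 0.
  rewrite preimage_nnfun0// !integral0_eq// => x _.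
    by rewrite indic0 mulr0 mul0e.
  by rewrite indic0 mulr0.
under eq_integral do rewrite EFinM.
under [RHS]eq_integral do rewrite EFinM -muleA.
rewrite !ge0_integralZl//.
- rewrite integral_indic// setIT /= /density_measure integral_mkcond.
  congr (_ * _)%E; apply: eq_integral => x _.
  by rewrite patchE indicE; case: ifPn => _; rewrite ?mul1e ?mul0e.
- by apply: emeasurable_funM => //; apply/measurable_EFinP.
- by move=> x _; rewrite mule_ge0// lee_fin.
- exact/measurable_EFinP.
Qed.

End density.
Arguments density_measure {d T R} mu {f} mf f_ge0.

(** * Bounded measurable functions and their integrals *)

Section bounded_measurable.
Context (d : measure_display) (T : measurableType d) (R : realType).
Implicit Types f g : T -> R.

(** This class is closed under ring operations and integrable under every probability, so
    integrability below follows from the shape of the integrand. *)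
Definition bounded_mfun f :=
  measurable_fun [set: T] f /\ exists M : R, forall x, `|f x| <= M.

Lemma bounded_mfun_cst r : bounded_mfun (cst r).
Proof. by split => //; exists `|r|. Qed.

Lemma bounded_mfunD f g :
  bounded_mfun f -> bounded_mfun g -> bounded_mfun (fun x => f x + g x).
Proof.
move=> [mf [M fM]] [mg [N gN]]; split; first exact: measurable_funD.
by exists (M + N) => x; rewrite (le_trans (ler_normD _ _))// lerD.
Qed.

Lemma bounded_mfunM f g :
  bounded_mfun f -> bounded_mfun g -> bounded_mfun (fun x => f x * g x).
Proof.
move=> [mf [M fM]] [mg [N gN]]; split; first exact: measurable_funM.
by exists (M * N) => x; rewrite normrM ler_pM.
Qed.

Lemma bounded_mfunZ r f : bounded_mfun f -> bounded_mfun (fun x => r * f x).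
Proof. exact: (bounded_mfunM (bounded_mfun_cst r)). Qed.

Lemma bounded_mfunB f g :
  bounded_mfun f -> bounded_mfun g -> bounded_mfun (fun x => f x - g x).
Proof.
move=> bf bg; under eq_fun do rewrite -mulN1r.
exact/bounded_mfunD/bounded_mfunZ.
Qed.

Lemma bounded_mfunX f p : bounded_mfun f -> bounded_mfun (fun x => f x ^+ p).
Proof.
move=> bf; elim: p => [|p IH]; first exact: bounded_mfun_cst.
by under eq_fun do rewrite exprS; exact: bounded_mfunM.
Qed.

Lemma bounded_mfun_sum I (r : seq I) (F : I -> T -> R) :
  (forall i, bounded_mfun (F i)) ->
  bounded_mfun (fun x => \sum_(i <- r) F i x).
Proof.
move=> bF; elim: r => [|i r IH].
  by under eq_fun do rewrite big_nil; exact: bounded_mfun_cst.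
by under eq_fun do rewrite big_cons; exact: bounded_mfunD.
Qed.

Lemma bounded_mfun_prod I (r : seq I) (P : pred I) (F : I -> T -> R) :
  (forall i, bounded_mfun (F i)) ->
  bounded_mfun (fun x => \prod_(i <- r | P i) F i x).
Proof.
move=> bF; elim: r => [|i r IH].
  by under eq_fun do rewrite big_nil; exact: bounded_mfun_cst.
under eq_fun do rewrite big_cons.
by case: (P i) => //; exact: bounded_mfunM.
Qed.

Lemma bounded_mfun_indic (A : set T) :
  measurable A -> bounded_mfun (\1_A : T -> R).
Proof.
move=> mA; split => //; exists 1 => x.
by rewrite indicE; case: (_ \in _); rewrite ?normr1 ?normr0.
Qed.

Lemma bounded_mfun_integrable (mu : {measure set T -> \bar R}) f :
  (mu [set: T] < +oo)%E -> bounded_mfun f ->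
  mu.-integrable [set: T] (EFin \o f).
Proof.
move=> mufin [mf [M fM]]; apply: measurable_bounded_integrable => //.
exists M; split; rewrite ?num_real// => N MN x _ /=.
exact: le_trans (fM x) (ltW MN).
Qed.

End bounded_measurable.

Lemma bounded_mfun_comp (d d' : measure_display) (S : measurableType d)
    (T : measurableType d') (R : realType) (h : S -> T) (f : T -> R) :
  measurable_fun [set: S] h -> bounded_mfun f -> bounded_mfun (f \o h).
Proof.
move=> mh [mf [M fM]]; split; first exact: measurableT_comp.
by exists M => x /=.
Qed.

Section bounded_integral.
Context (d : measure_display) (T : measurableType d) (R : realType).
Variable mu : probability T R.
Implicit Types f g : T -> R.

Lemma bounded_integrable f :
  bounded_mfun f -> mu.-integrable [set: T] (EFin \o f).
Proof.
move=> bf; apply: bounded_mfun_integrable => //.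
by rewrite (le_lt_trans (probability_le1 mu measurableT))// ltry.
Qed.

Lemma bounded_RintegralD f g : bounded_mfun f -> bounded_mfun g ->
  \int[mu]_x (f x + g x) = \int[mu]_x f x + \int[mu]_x g x.
Proof. by move=> bf bg; apply: RintegralD => //; exact: bounded_integrable. Qed.

Lemma bounded_RintegralB f g : bounded_mfun f -> bounded_mfun g ->
  \int[mu]_x (f x - g x) = \int[mu]_x f x - \int[mu]_x g x.
Proof. by move=> bf bg; apply: RintegralB => //; exact: bounded_integrable. Qed.

Lemma bounded_RintegralZl r f : bounded_mfun f ->
  \int[mu]_x (r * f x) = r * \int[mu]_x f x.
Proof. by move=> bf; apply: RintegralZl => //; exact: bounded_integrable. Qed.

Lemma probability_Rintegral_cst r : \int[mu]_x r = r.
Proof.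
rewrite Rintegral_cst//= [X in fine X](_ : _ = 1%E) ?mulr1//.
exact: (probability_setT mu).
Qed.

Lemma bounded_Rintegral_sum I (r : seq I) (F : I -> T -> R) :
  (forall i, bounded_mfun (F i)) ->
  \int[mu]_x (\sum_(i <- r) F i x) = \sum_(i <- r) \int[mu]_x F i x.
Proof.
move=> bF; elim: r => [|i r IH].
  under eq_Rintegral do rewrite big_nil.
  by rewrite probability_Rintegral_cst big_nil.
under eq_Rintegral do rewrite big_cons.
by rewrite bounded_RintegralD ?IH ?big_cons//; exact: bounded_mfun_sum.
Qed.

Lemma bounded_le_Rintegral f g : bounded_mfun f -> bounded_mfun g ->
  (forall x, f x <= g x) -> \int[mu]_x f x <= \int[mu]_x g x.
Proof.
by move=> bf bg fg; apply: le_Rintegral => //; exact: bounded_integrable.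
Qed.

Lemma Rintegral_indic_probability (A : set T) : measurable A ->
  (\int[mu]_x (\1_A x))%R = fine (mu A).
Proof. by move=> mA; rewrite /Rintegral integral_indic// setIT. Qed.

Lemma bounded_EFin_Rintegral f : bounded_mfun f ->
  (\int[mu]_x f x)%:E = (\int[mu]_x (f x)%:E)%E.
Proof.
by move=> bf; rewrite fineK//; apply: integrable_fin_num => //; exact: bounded_integrable.
Qed.

End bounded_integral.

(** Adding a bound [M] of [|g|] reduces to the nonnegative case; the contribution of the constant
    [M] is the same on both sides and cancels. *)
Lemma Rintegral_density_measure (d : measure_display) (T : measurableType d)
    (R : realType) (mu : {measure set T -> \bar R}) (f g : T -> R)
    (mf : measurable_fun [set: T] f) (f_ge0 : forall x, 0 <= f x) :
  mu.-integrable [set: T] (EFin \o f) -> bounded_mfun g ->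
  \int[density_measure mu mf f_ge0]_x g x = \int[mu]_x (g x * f x).
Proof.
move=> If [mg [M gM]]; set nu := density_measure mu mf f_ge0.
have M0 x : 0 <= g x + M.
  by rewrite addrC -[g x]opprK subr_ge0 (le_trans _ (gM x))// -normrN ler_norm.
have mgM : measurable_fun setT (fun x => g x + M) by exact: measurable_funD.
have Mg : bounded_mfun g by split => //; exists M.
have nufin : (nu setT < +oo)%E.
  rewrite /nu/= /density_measure; have /integrableP[_] := If.
  by under eq_integral do rewrite /= ger0_norm//.
have bI h : bounded_mfun h -> nu.-integrable setT (EFin \o h).
  exact: bounded_mfun_integrable.
have Igf : mu.-integrable setT (EFin \o (fun x => g x * f x)).
  apply: (le_integrable _ _ _ (integrableZl measurableT M If)) => //=.
    exact/measurable_EFinP/measurable_funM.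
  move=> x _; rewrite lee_fin !normrM ler_wpM2r// (le_trans (gM x))//.
  exact: ler_norm.
have : \int[nu]_x (g x + M) = \int[mu]_x ((g x + M) * f x).
  rewrite /Rintegral ge0_integral_density_measure//.
  exact/measurable_EFinP.
rewrite RintegralD//; [|exact: bI|exact/bI/bounded_mfun_cst].
rewrite Rintegral_cst//=.
under [RHS]eq_Rintegral do rewrite mulrDl.
rewrite RintegralD//; last exact: (integrableZl measurableT M If).
rewrite RintegralZl// => /eqP.
by rewrite [fine _]/(\int[mu]_x f x) (inj_eq (addIr _)) => /eqP.
Qed.

(** * Product probabilities and independent output sequences *)

Section product_probability.
Context (d1 d2 : measure_display) (T1 : measurableType d1)
  (T2 : measurableType d2) (R : realType).
Variables (m1 : probability T1 R) (m2 : probability T2 R).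

Definition product_probability : set (T1 * T2) -> \bar R := (m1 \x m2)%E.

HB.instance Definition _ := Measure.on product_probability.

Let product_probability_setT : product_probability [set: T1 * T2] = 1%E.
Proof.
rewrite -setXTT /product_probability product_measure1E//.
transitivity (1 * 1 : \bar R)%E; last exact: mule1.
by congr (_ * _)%E; exact: probability_setT.
Qed.

HB.instance Definition _ := Measure_isProbability.Build _ _ _
  product_probability product_probability_setT.

End product_probability.

Definition tuple_cons (Y : Type) n (z : Y * n.-tuple Y) : n.+1.-tuple Y :=
  [tuple of z.1 :: z.2].

Section iid.
Context (d : measure_display) (Y : measurableType d) (R : realType).
Variable nu : probability Y R.

Lemma measurable_tuple_cons n :
  measurable_fun [set: Y * n.-tuple Y] (@tuple_cons Y n).
Proof. exact: measurable_cons. Qed.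

HB.instance Definition _ n :=
  isMeasurableFun.Build _ _ _ _ (@tuple_cons Y n) (@measurable_tuple_cons n).

(** Adding one coordinate at a time makes Fubini on the first coordinate the induction step for
    integrals of product functions. *)
Fixpoint iid n : probability (n.-tuple Y) R :=
  if n is m.+1 then
    distribution (product_probability nu (iid m)) (@tuple_cons Y m)
  else dirac [tuple].

Lemma bounded_mfun_tnth n (h : Y -> R) (i : 'I_n) :
  bounded_mfun h -> bounded_mfun (fun v : n.-tuple Y => h (tnth v i)).
Proof. exact: (bounded_mfun_comp (measurable_tnth i)). Qed.

Lemma Rintegral_iid n (h : 'I_n -> Y -> R) :
  (forall i, bounded_mfun (h i)) ->
  \int[iid n]_v (\prod_(i < n) h i (tnth v i)) =
  \prod_(i < n) \int[nu]_y h i y.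
Proof.
elim: n h => [|n IH] h bh.
  under eq_Rintegral do rewrite big_ord0.
  by rewrite probability_Rintegral_cst big_ord0.
pose h' i := h (lift ord0 i).
have bh' : bounded_mfun
    (fun v : n.-tuple Y => \prod_(i < n) h' i (tnth v i)).
  by apply: bounded_mfun_prod => i; exact: (bounded_mfun_tnth i (bh _)).
have bf : bounded_mfun (fun v : n.+1.-tuple Y => \prod_(i < n.+1) h i (tnth v i)).
  by apply: bounded_mfun_prod => i; exact: (bounded_mfun_tnth i (bh i)).
have [mf _] := bf.
apply: EFin_inj; rewrite bounded_EFin_Rintegral//=.
have bc := bounded_mfun_comp (@measurable_tuple_cons n) bf.
rewrite integral_pushforward//; [|exact/measurable_EFinP|]; last first.
  by rewrite preimage_setT; exact: (bounded_integrable _ bc).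
rewrite preimage_setT.
transitivity (\int[nu]_y \int[iid n]_v
    (h ord0 y * \prod_(i < n) h' i (tnth v i))%:E)%E.
  rewrite -integral12_prod_meas1; last exact: (bounded_integrable _ bc).
  apply: eq_integral => y _; apply: eq_integral => v _ /=.
  rewrite big_ord_recl; congr (_ * _)%:E.
  by apply: eq_bigr => i _; rewrite tnthS.
transitivity (\int[nu]_y (h ord0 y * \prod_(i < n) \int[nu]_y h' i y)%:E)%E.
  apply: eq_integral => y _.
  rewrite -bounded_EFin_Rintegral; last exact: (bounded_mfunZ _ bh').
  by rewrite bounded_RintegralZl// IH// => i; exact: bh.
rewrite -bounded_EFin_Rintegral; last first.
  exact: (bounded_mfunM (bh ord0) (bounded_mfun_cst _ _)).
by rewrite big_ord_recl RintegralZr//; exact: bounded_integrable.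
Qed.
End iid.

Lemma measurable_rectangle (d : measure_display) (Y : measurableType d) n
    (A : 'I_n -> set Y) : (forall j, measurable (A j)) ->
  measurable [set v : n.-tuple Y | forall j, A j (tnth v j)].
Proof.
move=> mA; rewrite (_ : [set v | _] =
    \big[setI/setT]_(j < n) ((@tnth n Y ^~ j) @^-1` A j)).
  apply: bigsetI_measurable => j _; rewrite -[X in measurable X]setTI.
  exact: measurable_tnth.
rewrite -bigcap_seq; apply/seteqP; split => v /= Av j; first by move=> _; exact: Av.
by have := Av j; rewrite /= mem_index_enum; exact.
Qed.

(** The measurable rectangles are stable under intersection and generate the sigma-algebra of
    tuples, so they determine a finite measure. *)
Lemma tuple_measure_unique (d : measure_display) (Y : measurableType d)
    (R : realType) n (m1 m2 : {measure set (n.-tuple Y) -> \bar R}) :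
  (m1 [set: n.-tuple Y] < +oo)%E ->
  (forall A : 'I_n -> set Y, (forall j, measurable (A j)) ->
    m1 [set v | forall j, A j (tnth v j)] =
    m2 [set v | forall j, A j (tnth v j)]) ->
  forall B, measurable B -> m1 B = m2 B.
Proof.
move=> m1fin m12.
pose G := [set B : set (n.-tuple Y) | exists A : 'I_n -> set Y,
  (forall j, measurable (A j)) /\ B = [set v | forall j, A j (tnth v j)]].
have GT : G [set: n.-tuple Y].
  by exists (fun=> setT); split => //; apply/seteqP; split.
have mG : G `<=` measurable.
  by move=> _ [A [mA ->]]; exact: measurable_rectangle.
apply: (measure_unique G (fun=> setT)) => //.
- apply/seteqP; split; last exact: smallest_sub (sigma_algebra_measurable _) mG.
  apply: smallest_sub; first exact: smallest_sigma_algebra.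
  rewrite -bigcup_seq => _ [j _ /= [A mA <-]].
  (* A generating cylinder is the rectangle with one constrained side and full sides elsewhere. *)
  apply: sub_sigma_algebra; exists (fun i => if i == j then A else setT); split.
    by move=> i; case: ifP.
  rewrite setTI; apply/seteqP; split => v /=.
    by move=> Av i; case: eqP => [->|].
  by move=> /(_ j); rewrite eqxx.
- move=> _ _ [A [mA ->]] [A' [mA' ->]].
  exists (fun j => A j `&` A' j); split => [j|]; first exact: measurableI.
  by apply/seteqP; split => v /= => [[Av A'v] j|AA']; split=> // j; case: (AA' j).
- by rewrite bigcup_const.
- by move=> _ [A [mA ->]]; exact: m12.
Qed.

(** * The function x ln x *)

Section entropy_function.
Context (R : realType).

Lemma ln_le_sub1 (x : R) : 0 < x -> ln x <= x - 1.
Proof.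
by move=> x0; have := @le_ln1Dx R (x - 1); rewrite subrKC; apply; lra.
Qed.

Definition xlnx (x : R) : R := x * ln x.

Lemma measurable_xlnx : measurable_fun [set: R] xlnx.
Proof. by apply: measurable_funM => //; exact: measurable_ln. Qed.

Lemma xlnx_ge x : 0 <= x -> x - 1 <= xlnx x.
Proof.
rewrite le_eqVlt => /predU1P[<-|x0]; first by rewrite /xlnx mul0r; lra.
have : ln x^-1 <= x^-1 - 1 by rewrite ln_le_sub1// invr_gt0.
rewrite lnV ?posrE// => H.
rewrite /xlnx -subr_ge0.
have -> : x * ln x - (x - 1) = x * (x^-1 - 1 - - ln x).
  by field; rewrite gt_eqF.
by rewrite mulr_ge0 ?(ltW x0)// subr_ge0.
Qed.

(** The factors of the likelihood lie in [0, 2], so this bound makes their [xlnx] integrable. Above,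
    x ln x is at most x (x - 1); below, it is at least x - 1. *)
Lemma norm_xlnx_le x : 0 <= x <= 2 -> `|xlnx x| <= 2.
Proof.
move=> /andP[x0 x2]; rewrite ler_norml; apply/andP; split.
  by have := xlnx_ge x0; lra.
move: x0; rewrite le_eqVlt => /predU1P[<-|x0]; first by rewrite /xlnx mul0r; lra.
have H := ln_le_sub1 x0.
rewrite (@le_trans _ _ (x * (x - 1)))// ?ler_wpM2l ?(ltW x0)//.
by nra.
Qed.

End entropy_function.

(** * The channel under a uniform input *)

Section channel_facts.
Context (d : measure_display) (Y : measurableType d) (R : realType).
Variable W : mbios Y R.
Local Notation pdf := (chan_pdf W).
Local Notation ref := (chan_ref W).
Local Notation opp := (chan_opp W).

Definition mean_pdf y : R := (pdf false y + pdf true y) / 2.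

(* The conditional mean of the sent sign given the output [y] when the input
   is uniform, that is [tanh (llr y / 2)]. *)
Definition soft_bit y : R := (pdf false y - pdf true y) / (pdf false y + pdf true y).

Lemma mean_pdf_ge0 y : 0 <= mean_pdf y.
Proof. by rewrite divr_ge0// addr_ge0// chan_pdf_ge0. Qed.

Lemma measurable_mean_pdf : measurable_fun [set: Y] mean_pdf.
Proof.
by apply: measurable_funM => //; apply: measurable_funD; exact: measurable_chan_pdf.
Qed.

Lemma measurable_soft_bit : measurable_fun [set: Y] soft_bit.
Proof.
(* The quotient becomes a product with a real power, which is a measurable function of its base;
   both forms of the inverse are 0 at 0. *)
rewrite (_ : soft_bit = fun y =>
    (pdf false y - pdf true y) * (pdf false y + pdf true y) `^ (-1)); last first.
  by apply/funext => y; rewrite powR_inv1// addr_ge0// chan_pdf_ge0.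
apply: measurable_funM.
  by apply: measurable_funB; exact: measurable_chan_pdf.
apply: (measurableT_comp (measurable_powR _)).
by apply: measurable_funD; exact: measurable_chan_pdf.
Qed.

Lemma soft_le1 y : `|soft_bit y| <= 1.
Proof.
have p0 := chan_pdf_ge0 W false y; have p1 := chan_pdf_ge0 W true y.
rewrite /soft_bit; have [->|ne0] := eqVneq (pdf false y + pdf true y) 0.
  by rewrite invr0 mulr0 normr0.
rewrite normrM normfV (ger0_norm (addr_ge0 p0 p1)) ler_pdivrMr ?mul1r.
  by rewrite ler_norml; apply/andP; split; lra.
by rewrite lt0r ne0 addr_ge0.
Qed.

Lemma bounded_soft : bounded_mfun soft_bit.
Proof. by split; [exact: measurable_soft_bit|exists 1; exact: soft_le1]. Qed.

(** Hence [1 + (-1) ^+ s * soft_bit y] is the density of the output law given [s] with respect to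
    the output law under a uniform input. Where the mean density vanishes, so do both conditional
    densities. *)
Lemma chan_pdfE s y : pdf s y = (1 + (-1) ^+ s * soft_bit y) * mean_pdf y.
Proof.
have p0 := chan_pdf_ge0 W false y; have p1 := chan_pdf_ge0 W true y.
rewrite /soft_bit /mean_pdf.
have [e|ne0] := eqVneq (pdf false y + pdf true y) 0.
  by rewrite e mul0r mulr0; case: s; lra.
by case: s; field.
Qed.

Lemma soft_opp y : soft_bit (opp y) = - soft_bit y.
Proof.
rewrite /soft_bit [pdf false (opp y)]chan_sym chan_oppK [pdf false y]chan_sym.
by rewrite -mulNr opprB [X in _ / X = _]addrC.
Qed.

Lemma mean_pdf_opp y : mean_pdf (opp y) = mean_pdf y.
Proof.
by rewrite /mean_pdf [pdf false (opp y)]chan_sym chan_oppK [pdf false y]chan_sym addrC.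
Qed.

Lemma integral_pdf s : (\int[ref]_y (pdf s y)%:E = 1)%E.
Proof. by rewrite -chan_lawE// probability_setT. Qed.

Lemma integrable_pdf s : ref.-integrable [set: Y] (EFin \o pdf s).
Proof.
apply/integrableP; split; first exact/measurable_EFinP/measurable_chan_pdf.
under eq_integral do rewrite /= ger0_norm ?chan_pdf_ge0//.
by rewrite integral_pdf ltry.
Qed.

Let EFin_mean_pdf y : (EFin \o mean_pdf) y =
  (2^-1%:E * ((pdf false y)%:E + (pdf true y)%:E))%E.
Proof. by rewrite /= -EFinD -EFinM mulrC. Qed.

Lemma integrable_mean_pdf : ref.-integrable [set: Y] (EFin \o mean_pdf).
Proof.
rewrite (funext EFin_mean_pdf).
apply: integrableZl => //.
exact: integrableD (integrable_pdf _) (integrable_pdf _).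
Qed.

Definition output_law : set Y -> \bar R :=
  density_measure ref measurable_mean_pdf mean_pdf_ge0.

HB.instance Definition _ := Measure.on output_law.

Let output_law_setT : output_law [set: Y] = 1%E.
Proof.
rewrite /output_law /density_measure; under eq_integral do rewrite [(_)%:E]EFin_mean_pdf.
rewrite integralZl//; last exact: integrableD (integrable_pdf _) (integrable_pdf _).
rewrite integralD//; [|exact: integrable_pdf..].
by rewrite !integral_pdf -EFinD -EFinM; congr EFin; field.
Qed.

HB.instance Definition _ := Measure_isProbability.Build _ _ _ output_law output_law_setT.

Lemma Rintegral_output_law g : bounded_mfun g ->
  \int[output_law]_y g y = \int[ref]_y (g y * mean_pdf y).
Proof. exact: (Rintegral_density_measure _ _ integrable_mean_pdf). Qed.

Lemma chan_law_output_law s A : measurable A ->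
  fine (chan_law W s A) = \int[output_law]_y (\1_A y * (1 + (-1) ^+ s * soft_bit y)).
Proof.
move=> mA; rewrite chan_lawE// Rintegral_output_law; last first.
  apply: bounded_mfunM; first exact: bounded_mfun_indic.
  apply: bounded_mfunD; first exact: bounded_mfun_cst.
  exact/bounded_mfunZ/bounded_soft.
rewrite /Rintegral [in LHS]integral_mkcond; congr fine; apply: eq_integral => y _.
rewrite patchE indicE; case: ifPn => _; last by rewrite !mul0r.
by rewrite mul1r -chan_pdfE.
Qed.

(** The involution preserves the reference measure and the mean density, hence the output law. *)
Lemma Rintegral_output_law_opp g : bounded_mfun g ->
  \int[output_law]_y g (opp y) = \int[output_law]_y g y.
Proof.
move=> bg; have [mg _] := bg; have mo := measurable_chan_opp W.
have bgo := bounded_mfun_comp mo bg.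
apply: EFin_inj; rewrite !bounded_EFin_Rintegral//.
transitivity (\int[pushforward output_law opp]_y (g y)%:E)%E.
  rewrite integral_pushforward//; first exact/measurable_EFinP.
  by rewrite preimage_setT; exact: (bounded_integrable _ bgo).
apply: eq_measure_integral => A mA _.
rewrite /pushforward /= /output_law /density_measure.
transitivity (\int[ref]_(y in opp @^-1` A) (mean_pdf (opp y))%:E)%E.
  by apply: eq_integral => y _; rewrite mean_pdf_opp.
rewrite -[LHS](@ge0_integral_pushforward _ _ _ _ _ _ mo ref A (EFin \o mean_pdf))//.
- by apply: eq_measure_integral => B mB _; exact: chan_ref_opp.
- by apply: measurable_funTS; exact/measurable_EFinP/measurable_mean_pdf.
- by move=> y _; rewrite lee_fin mean_pdf_ge0.
Qed.

(** The involution negates [soft_bit] and preserves the output law, so an odd moment equals its own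
    opposite. *)
Lemma Rintegral_soft_odd p : odd p -> \int[output_law]_y (soft_bit y ^+ p) = 0.
Proof.
move=> op; have bp := bounded_mfunX p bounded_soft.
have := Rintegral_output_law_opp bp.
under eq_Rintegral do rewrite soft_opp exprNn -signr_odd op expr1 mulN1r -mulN1r.
rewrite bounded_RintegralZl//; lra.
Qed.

End channel_facts.

(** * The capacity and [g_] as means under the output law *)

Section channel_quantities.
Context (d : measure_display) (Y : measurableType d) (R : realType).
Variable W : mbios Y R.
Local Notation pdf := (chan_pdf W).
Local Notation ref := (chan_ref W).
Local Notation soft := (soft_bit W).
Local Notation nu := (output_law W).

Lemma signed_soft_itv (s : input) y : 0 <= 1 + (-1) ^+ s * soft y <= 2.
Proof.
have := soft_le1 W y; rewrite ler_norml => /andP[? ?].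
by case: s; apply/andP; split; lra.
Qed.

Lemma bounded_signed_soft (s : input) : bounded_mfun (fun y => 1 + (-1) ^+ s * soft y).
Proof.
apply: bounded_mfunD; first exact: bounded_mfun_cst.
exact/bounded_mfunZ/bounded_soft.
Qed.

Lemma bounded_xlnx_soft (s : input) :
  bounded_mfun (fun y => xlnx (1 + (-1) ^+ s * soft y)).
Proof.
split.
  apply: (measurableT_comp (@measurable_xlnx R)).
  by have [] := bounded_signed_soft s.
by exists 2 => y; rewrite norm_xlnx_le// signed_soft_itv.
Qed.

Lemma Rintegral_xlnx_soft_sym (s : input) :
  \int[nu]_y xlnx (1 + (-1) ^+ s * soft y) =
  \int[nu]_y xlnx (1 + soft y).
Proof.
rewrite -(Rintegral_output_law_opp W (bounded_xlnx_soft s)).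
case: s; first by apply: eq_Rintegral => y _; rewrite soft_opp expr1 mulN1r opprK.
have b0 := bounded_xlnx_soft false.
rewrite (Rintegral_output_law_opp W b0).
by apply: eq_Rintegral => y _; rewrite expr0 mul1r.
Qed.

(** With a uniform input the mutual information is the mean of two relative entropies to the output
    law, and the symmetry of the channel makes them equal. *)
Lemma capacityE : capacity W * ln 2 = \int[nu]_y xlnx (1 + soft y).
Proof.
rewrite /capacity /mutual_information big_bool /=.
have E s : \int[ref]_y (pdf s y *
    log2 (pdf s y / \sum_(t : input) 2^-1 * pdf t y)) =
    (ln 2)^-1 * \int[nu]_y xlnx (1 + soft y).
  rewrite -(Rintegral_xlnx_soft_sym s) -bounded_RintegralZl; last exact: bounded_xlnx_soft.
  rewrite Rintegral_output_law; last exact/bounded_mfunZ/bounded_xlnx_soft.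
  apply: eq_Rintegral => y _; rewrite big_bool /=.
  have -> : 2^-1 * pdf true y + 2^-1 * pdf false y = mean_pdf W y.
    by rewrite /mean_pdf -mulrDr mulrC addrC.
  (* Where the mean density is 0 both sides are 0; elsewhere it cancels in the quotient and leaves
     [1 + (-1) ^+ s * soft y]. *)
  rewrite chan_pdfE; have [->|q0] := eqVneq (mean_pdf W y) 0.
    by rewrite !mulr0 mul0r.
  by rewrite mulfK// /log2 /xlnx; ring.
rewrite !E; have : ln 2 != 0 :> R by rewrite gt_eqF// ln_gt0// ltr1n.
by move=> ?; field.
Qed.

(** Applied to the two densities, this identifies tanh of half the LLR with [soft_bit]. The proof
    substitutes the square roots [a] and [b] of [x] and [y]. *)
Lemma tanh_half_ln (x y : R) : 0 < x -> 0 < y ->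
  tanh ((ln x - ln y) / 2) = (x - y) / (x + y).
Proof.
move=> x0 y0; rewrite /tanh.
set a := expR (ln x / 2); set b := expR (ln y / 2).
have a0 : 0 < a by exact: expR_gt0.
have b0 : 0 < b by exact: expR_gt0.
have -> : - ((ln x - ln y) / 2) = (ln y - ln x) / 2 by ring.
rewrite !mulrBl !expRB -/a -/b.
have -> : x = a ^+ 2 by rewrite -expRM_natl mulrC divfK// lnK.
have -> : y = b ^+ 2 by rewrite -expRM_natl mulrC divfK// lnK.
have : a ^+ 2 + b ^+ 2 != 0 by rewrite gt_eqF// addr_gt0// exprn_gt0.
by move=> ab; field; rewrite ab !gt_eqF.
Qed.

Lemma even_soft_ge0 p y : 0 <= soft y ^+ (2 * p).
Proof. by rewrite exprM exprn_ge0// sqr_ge0. Qed.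

Definition g_integrand p (l : \bar R) : \bar R :=
  ((1 + expeR (- l)) * etanh (l * 2^-1%:E) ^+ (2 * p))%E.

(** A real-valued form that yields nonnegativity and measurability. At [+oo] the exponential is 0
    and the hyperbolic tangent is 1, whence the value 1. *)
Lemma g_integrandE p l : (0 <= l)%E -> g_integrand p l =
  (if l == +oo%E then 1 else
   (1 + expR (- fine l)) * tanh (fine l / 2) ^+ (2 * p))%:E.
Proof.
case: l => [r||] //= _; rewrite /g_integrand.
  by rewrite /= -!EFin_expe -EFinM.
by rewrite gt0_mulye ?lte_fin//= adde0 -EFin_expe expr1n mule1.
Qed.

Lemma g_integrand_ge0 p l : (0 <= l)%E -> (0 <= g_integrand p l)%E.
Proof.
move=> l0; rewrite g_integrandE// lee_fin; case: ifP => // _.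
by rewrite mulr_ge0// exprM exprn_ge0// sqr_ge0.
Qed.

Lemma measurable_tanh : measurable_fun [set: R] (@tanh R).
Proof.
apply: continuous_measurable_fun => x; rewrite /tanh.
apply: cvgM.
  apply: cvgB; first exact: continuous_expR.
  by apply: (@continuous_comp _ _ _ -%R expR x); [exact: opp_continuous|exact: continuous_expR].
apply: cvgV; first by rewrite gt_eqF// addr_gt0// expR_gt0.
apply: cvgD; first exact: continuous_expR.
by apply: (@continuous_comp _ _ _ -%R expR x); [exact: opp_continuous|exact: continuous_expR].
Qed.

Lemma measurable_g_integrand p : measurable_fun [set l | 0 <= l]%E (g_integrand p).
Proof.
apply: (eq_measurable_fun (fun l : \bar R => (if l == +oo%E then 1 else
   (1 + expR (- fine l)) * tanh (fine l / 2) ^+ (2 * p))%:E)).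
  by move=> l; rewrite inE /= => l0; rewrite g_integrandE.
apply: measurable_funTS; apply/measurable_EFinP.
have mfine : measurable_fun [set: \bar R] (@fine R) by exact: fine_measurable.
apply: measurable_fun_ifT => //; first exact: measurable_fun_eqe.
apply: measurable_funM.
  apply: measurable_funD => //; apply: (measurableT_comp (@measurable_expR R)).
  exact: measurable_funN.
apply: measurable_funX; apply: (measurableT_comp measurable_tanh).
exact: measurable_funM.
Qed.

Lemma llrE y : 0 < pdf false y -> llr W y =
  if pdf true y == 0 then +oo%E else (ln (pdf false y) - ln (pdf true y))%:E.
Proof.
move=> p0; have p1 := chan_pdf_ge0 W true y; rewrite /llr inver.
case: eqVneq => [_|ne0]; first by rewrite gt0_muley ?lte_fin.
have q0 : 0 < pdf true y by rewrite lt0r ne0.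
by rewrite -EFinM lne_EFin ?divr_gt0// ln_div ?posrE.
Qed.

Lemma soft_ge0 y : 0 < pdf false y -> (0 <= soft y) = (pdf true y <= pdf false y).
Proof.
move=> p0; have p1 := chan_pdf_ge0 W true y.
by rewrite /soft_bit pmulr_lge0 ?subr_ge0// invr_gt0 ltr_pwDl.
Qed.

(** At l = [llr W y], multiplying [pdf false y] by exp (- l) gives [pdf true y], so the factor 1 +
    exp (- l) turns [pdf false y] into twice the mean density. The half-line l >= 0 becomes the
    condition [0 <= soft y]. *)
Lemma g_integrand_llr p y :
  (((g_integrand p \o llr W) \_ (llr W @^-1` [set l | 0 <= l])) y *
     (pdf false y)%:E =
   (2 * (soft y ^+ (2 * p) * (0 <= soft y)%R%:R) * mean_pdf W y)%:E)%E.
Proof.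
have p1 := chan_pdf_ge0 W true y; have := chan_pdf_ge0 W false y.
rewrite le_eqVlt => /predU1P[p0|p0].
  (* Here the left side is 0. On the right either both densities vanish, or [soft y] is -1 and the
     indicator is 0. *)
  rewrite -p0 mule0; have [q0|q0] := eqVneq (pdf true y) 0.
    by rewrite /mean_pdf -p0 q0 addr0 mul0r mulr0.
  rewrite /soft_bit -p0 sub0r add0r mulNr divff// oppr_ge0 ler10 /=.
  by rewrite !mulr0 mul0r.
rewrite patchE; case: ifPn; rewrite ?inE ?notin_setE /= => l0.
  rewrite g_integrandE// soft_ge0//; rewrite llrE// in l0 *.
  move: l0; case: eqVneq => [p1_0 _|p1_0].
    rewrite eqxx p1_0 (ltW p0) mulr1 /mean_pdf /soft_bit p1_0 subr0 addr0.
    by rewrite divff ?gt_eqF// expr1n mul1e; congr EFin; field.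
  have q0 : 0 < pdf true y by rewrite lt0r p1_0.
  rewrite lee_fin subr_ge0 ler_ln ?posrE// => qp; rewrite qp /=.
  rewrite tanh_half_ln// opprB expRB !lnK ?posrE// -/(soft_bit W y).
  rewrite -EFinM; congr EFin; rewrite /mean_pdf mulr1.
  by field; rewrite gt_eqF.
rewrite mul0e soft_ge0//; move: l0; rewrite llrE//; case: eqVneq => [_|p1_0].
  by rewrite leey.
have q0 : 0 < pdf true y by rewrite lt0r p1_0.
rewrite lee_fin subr_ge0 ler_ln ?posrE// => /negP/negPf ->.
by rewrite !mulr0 mul0r.
Qed.

(** Pulling the LLR law back to the outputs gives twice the integral over [0 <= soft y]. One of the
    two copies is reflected by the involution, and together they cover all outputs. *)
Lemma g_E p : (0 < p)%N -> g_ W p = \int[nu]_y (soft y ^+ (2 * p)).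
Proof.
move=> p0; pose D := [set l : \bar R | 0 <= l]%E.
have mD : measurable D.
  rewrite (_ : D = [set` `[0%E, +oo%E[ ] `|` [set +oo%E]).
    by apply: measurableU; [exact: emeasurable_itv|exact: emeasurable_set1].
  apply/seteqP; split => [[r||]|l] //=; rewrite ?in_itv /=.
  - by move=> ->; left; rewrite ltry.
  - by right.
  - by move=> [/andP[]//|->]; exact: leey.
have ml := measurable_llr W.
have mD' : measurable (llr W @^-1` D).
  by rewrite -[X in measurable X]setTI; exact: ml.
have mg : measurable_fun (llr W @^-1` D) (g_integrand p \o llr W).
  apply: (measurable_comp mD); first by move=> _ [y Dy <-].
    exact: measurable_g_integrand.
  exact: measurable_funTS.
pose k y := soft y ^+ (2 * p) * (0 <= soft y)%R%:R.
have bs := bounded_soft W.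
have bk : bounded_mfun k.
  apply: bounded_mfunM; first exact: bounded_mfunX.
  rewrite (_ : (fun y => _) = \1_(soft @^-1` `[0, +oo[)); last first.
    apply/funext => y; rewrite indicE; congr (nat_of_bool _)%:R.
    by apply/idP/idP; rewrite inE /= in_itv /= andbT.
  apply: bounded_mfun_indic; rewrite -[X in measurable X]setTI.
  by apply: bs.1.
have -> : g_ W p = \int[nu]_y (2 * k y).
  rewrite Rintegral_output_law; last exact: bounded_mfunZ.
  rewrite /g_ /Rintegral; congr fine.
  rewrite -[LHS]/(\int[pushforward (chan_law W false) (llr W)]_(l in D) g_integrand p l)%E.
  rewrite ge0_integral_pushforward//; last 2 first.
  - exact: measurable_g_integrand.
  - by move=> l; rewrite inE; exact: g_integrand_ge0.
  rewrite (eq_measure_integral (density_measure ref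
    (measurable_chan_pdf W false) (chan_pdf_ge0 W false))); last first.
    by move=> A mA _; exact: chan_lawE.
  rewrite integral_mkcond ge0_integral_density_measure//.
  - by apply: eq_integral => y _; rewrite g_integrand_llr.
  - exact/(measurable_restrictT _ mD').
  - by move=> y; apply: erestrict_ge0 => z; exact: g_integrand_ge0.
have bko := bounded_mfun_comp (measurable_chan_opp W) bk.
rewrite bounded_RintegralZl// mulr_natl mulr2n -[X in X + _](Rintegral_output_law_opp W bk).
rewrite -bounded_RintegralD//; apply: eq_Rintegral => y _.
rewrite /k soft_opp exprNn exprM sqrrN expr1n expr1n mul1r oppr_ge0.
have [s0|s0|->] := ltgtP (soft y) 0; rewrite /= ?mulr0 ?mulr1 ?addr0 ?add0r//.
(* Outputs with [soft y = 0] are counted twice, but their contribution is 0 because [p] is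
   positive. *)
by rewrite expr0n muln_eq0 /= eqn0Ngt p0 addr0.
Qed.

End channel_quantities.

(** * Likelihoods and the joint law of information and output *)

Section likelihood.
Context (d : measure_display) (Y : measurableType d) (R : realType).
Variables (W : mbios Y R) (n : nat).
Local Notation soft := (soft_bit W).
Local Notation nu := (output_law W).
Local Notation Q := (iid nu n).
Implicit Types (x : 'I_n -> input) (v : n.-tuple Y) (A : {set 'I_n}).

Definition likelihood x v : R := \prod_(j < n) (1 + (-1) ^+ x j * soft (tnth v j)).

Definition soft_prod A v : R := \prod_(j in A) soft (tnth v j).

Lemma bounded_likelihood x : bounded_mfun (likelihood x).
Proof.
apply: bounded_mfun_prod => j.
exact: (bounded_mfun_tnth j (bounded_signed_soft W (x j))).
Qed.

Lemma likelihood_ge0 x v : 0 <= likelihood x v.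
Proof. by apply: prodr_ge0 => j _; have /andP[] := signed_soft_itv W (x j) (tnth v j). Qed.

Lemma bounded_soft_prod A : bounded_mfun (soft_prod A).
Proof.
apply: bounded_mfun_prod => j; exact: (bounded_mfun_tnth j (bounded_soft W)).
Qed.

Lemma soft_prod_le1 A v : `|soft_prod A v| <= 1.
Proof.
rewrite normr_prod; apply: prodr_ile1 => j _.
by rewrite normr_ge0 soft_le1.
Qed.

Lemma Rintegral_likelihood_rect x (A : 'I_n -> set Y) :
  (forall j, measurable (A j)) ->
  \int[Q]_v (\1_[set v | forall j, A j (tnth v j)] v * likelihood x v) =
  \prod_(j < n) fine (chan_law W (x j) (A j)).
Proof.
move=> mA; pose h j y := \1_(A j) y * (1 + (-1) ^+ x j * soft y).
have bh j : bounded_mfun (h j).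
  by apply: bounded_mfunM; [exact: bounded_mfun_indic|exact: bounded_signed_soft].
rewrite (eq_bigr (fun j => \int[nu]_y h j y)); last first.
  by move=> j _; rewrite chan_law_output_law.
rewrite -Rintegral_iid//; apply: eq_Rintegral => v _.
rewrite /h big_split/=; congr (_ * _); rewrite indicE.
have [Av|nAv] := boolP (v \in _).
  rewrite big1// => j _; rewrite indicE mem_set//.
  by move: Av; rewrite inE /=.
move: nAv; rewrite notin_setE /= => /existsNP[j nAj].
by rewrite (bigD1 j)//= indicE memNset// mul0r.
Qed.

Lemma Rintegral_likelihood x : \int[Q]_v likelihood x v = 1.
Proof.
have := @Rintegral_likelihood_rect x (fun=> setT) (fun=> measurableT).
rewrite big1; last by move=> j _; rewrite [X in fine X](_ : _ = 1%E)//; exact: probability_setT.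
by move=> <-; apply: eq_Rintegral => v _; rewrite indicE mem_set ?mul1r.
Qed.

(** [transmission] describes only rectangles, whereas decision regions are arbitrary measurable
    sets; two finite measures that agree on rectangles agree on all of them. *)
Lemma joint_law (d' : measure_display) (Omega : measurableType d')
    (P : probability Omega R) (k : nat) (enc : 'rV['F_2]_k -> 'rV['F_2]_n)
    (U : Omega -> 'rV['F_2]_k) (V : Omega -> n.-tuple Y) u (B : set (n.-tuple Y)) :
  transmission P W enc U V -> measurable B ->
  fine (P ([set w | U w = u] `&` V @^-1` B)) =
  (2 ^+ k)^-1 * \int[Q]_v (\1_B v * likelihood (fun j => modulate (enc u 0 j)) v).
Proof.
move=> [mU PU mV PUV] mB; pose x j := modulate (enc u 0 j); rewrite -/x.
have [mJ _] := bounded_likelihood x.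
have k0 : 0 <= (2 ^+ k)^-1 :> R by rewrite invr_ge0 exprn_ge0.
pose c : {nonneg R} := NngNum k0.
(* [m1] is the law of [V] restricted to the event [U = u], and [m2] the likelihood density scaled by
   the probability of [u]. *)
pose law : {measure set (n.-tuple Y) -> \bar R} := pushforward (mrestr P (mU u)) V.
pose m1 := law mV.
pose m2 : {measure set (n.-tuple Y) -> \bar R} :=
  mscale c (density_measure Q mJ (likelihood_ge0 x)).
have m2E B' : measurable B' -> m2 B' =
    ((2 ^+ k)^-1 * \int[Q]_v (\1_B' v * likelihood x v))%:E.
  move=> mB'; rewrite EFinM bounded_EFin_Rintegral; last first.
    by apply: bounded_mfunM; [exact: bounded_mfun_indic|exact: bounded_likelihood].
  rewrite /m2/= /mscale/= /density_measure integral_mkcond; congr (_ * _)%E.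
  apply: eq_integral => v _; rewrite patchE indicE.
  by case: ifPn => _; rewrite ?mul1r ?mul0r.
have m1E B' : m1 B' = P ([set w | U w = u] `&` V @^-1` B').
  by rewrite /m1/= /pushforward /mrestr setIC.
rewrite -m1E (tuple_measure_unique (m2 := m2))//; first by rewrite m2E.
- by rewrite m1E preimage_setT setIT PU ltry.
- move=> A mA; rewrite m1E PUV// PU m2E; last exact: measurable_rectangle.
  rewrite Rintegral_likelihood_rect// EFinM; congr (_ * _)%E.
  rewrite -prodEFin; apply: eq_bigr => j _.
  by rewrite fineK// fin_num_measure.
Qed.

End likelihood.

(** * A lower bound for the logarithm by its Taylor polynomial *)

Section ln_taylor.
Context (R : realType).
Implicit Types x lam : R.

(** The series of ln (1 + x) is cut after an even number of terms and grouped in pairs, because the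
    two powers of a check product in a pair have the same mean given a codeword. *)
Definition ln_taylor M x : R :=
  \sum_(p < M) (x ^+ (2 * p).+1 / (2 * p).+1%:R - x ^+ (2 * p).+2 / (2 * p).+2%:R).

Lemma is_derive_monomial x n :
  is_derive x 1 (fun y : R => y ^+ n.+1 / n.+1%:R) (x ^+ n).
Proof.
rewrite (_ : (fun y => _) = n.+1%:R^-1 \*: ((@id R) ^+ n.+1)); last first.
  by apply/funext => y; rewrite /= exprfctE [RHS]mulrC.
apply: is_derive_eq.
by rewrite /= -[_%:A]/(_ * _ * 1) -[_ *: _]/(_ * _) mulr1 mulrA mulVf ?mul1r.
Qed.

(** The derivative of the polynomial is a partial geometric sum of 1 / (1 + x). The even exponent in
    the remainder makes it nonnegative. *)
Lemma is_derive_ln_taylor M x : - 1 < x ->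
  is_derive x 1 (fun y => ln (1 + y) - ln_taylor M y) (x ^+ (2 * M) / (1 + x)).
Proof.
move=> x1; have x0 : 0 < 1 + x by lra.
elim: M => [|M IH].
  rewrite (_ : (fun y => _) = (@ln R) \o (fun y => 1 + y)); last first.
    by apply/funext => y; rewrite /ln_taylor big_ord0 subr0.
  have H := is_derive1_ln x0.
  rewrite muln0 expr0 mul1r -[X in is_derive _ _ _ X]mulr1.
  apply: is_derive1_comp.
  rewrite (_ : (fun y => _) = cst 1 + id)//.
  by apply: is_derive_eq; rewrite add0r.
have H1 := is_derive_monomial x (2 * M).
have H2 := is_derive_monomial x (2 * M).+1.
rewrite (_ : (fun y => _) = (fun y => ln (1 + y) - ln_taylor M y)
    - (fun y : R => y ^+ (2 * M).+1 / (2 * M).+1%:R)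
    + (fun y : R => y ^+ (2 * M).+2 / (2 * M).+2%:R)); last first.
  by apply/funext => y; rewrite /ln_taylor big_ord_recr/= !fctE; ring.
apply: is_derive_eq.
rewrite mulnS !exprS; field.
by rewrite gt_eqF.
Qed.

(** By the mean value theorem, the remainder is nonnegative to the right of 0; to the left it is at
    least minus the maximal derivative, since [|x|] is at most 1. *)
Lemma ln_taylor_le M lam x : lam < 1 -> `|x| <= lam ->
  ln_taylor M x - lam ^+ (2 * M) / (1 - lam) <= ln (1 + x).
Proof.
move=> lam1 xlam; have lam0 : 0 <= lam by rewrite (le_trans _ xlam).
have x1 : - 1 < x by move: xlam; rewrite ler_norml => /andP[? ?]; lra.
pose f y := ln (1 + y) - ln_taylor M y.
have f0 : f 0 = 0.
  rewrite /f addr0 ln1 /ln_taylor big1 ?subrr// => p _.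
  by rewrite !expr0n /= !mul0r subrr.
have main a b : a <= b -> - lam <= a -> b <= lam -> exists2 c, `|c| <= lam &
    f b - f a = c ^+ (2 * M) / (1 + c) * (b - a).
  move=> ab la lb.
  have dv (y : R) : y \in `[a, b] -> is_derive y 1 f (y ^+ (2 * M) / (1 + y)).
    by rewrite in_itv /= => /andP[? ?]; apply: is_derive_ln_taylor; lra.
  have dvoo (y : R) : y \in `]a, b[ -> is_derive y 1 f (y ^+ (2 * M) / (1 + y)).
    by move=> yab; apply: dv; exact: subset_itv_oo_cc.
  have cf : {within `[a, b], continuous f}.
    by apply: derivable_within_continuous => y yab; have [] := dv _ yab.
  have [c] := MVT_segment ab dvoo cf.
  rewrite in_itv /= => /andP[? ?] ->; exists c => //.
  by rewrite ler_norml; apply/andP; split; lra.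
have bnd c : `|c| <= lam -> 0 <= c ^+ (2 * M) / (1 + c) <= lam ^+ (2 * M) / (1 - lam).
  move=> clam; have /andP[c1 c2] : - lam <= c <= lam by rewrite -ler_norml.
  have e0 : 0 <= c ^+ (2 * M) by rewrite exprM exprn_ge0// sqr_ge0.
  rewrite divr_ge0//=; last lra.
  rewrite ler_pM//; first by rewrite invr_ge0; lra.
    by rewrite -[c ^+ _]ger0_norm// normrX lerXn2r// nnegrE.
  by rewrite lef_pV2 ?posrE; lra.
set K := lam ^+ (2 * M) / (1 - lam) in bnd *.
suff : - K <= f x by rewrite /f; lra.
move: (xlam); rewrite ler_norml => /andP[xl xu].
have [x0|x0] := leP 0 x.
  have [c clam] := main 0 x x0 ltac:(lra) xu.
  rewrite f0 !subr0 => ->; have /andP[fc0 fcK] := bnd c clam.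
  apply: (@le_trans _ _ 0); last by rewrite mulr_ge0.
  by rewrite oppr_le0 (le_trans fc0).
have [c clam] := main x 0 (ltW x0) xl lam0.
rewrite f0 !sub0r => fE; have /andP[fc0 fcK] := bnd c clam.
rewrite -[f x]opprK fE lerN2 -[leRHS]mulr1 ler_pM//; lra.
Qed.

End ln_taylor.

Lemma ln_prod (R : realType) (I : Type) (r : seq I) (F : I -> R) :
  (forall i, 0 < F i) -> ln (\prod_(i <- r) F i) = \sum_(i <- r) ln (F i).
Proof.
move=> F0; elim: r => [|i r IH]; first by rewrite !big_nil ln1.
by rewrite !big_cons lnM ?posrE ?IH// prodr_gt0.
Qed.

(** This is the additivity of the logarithm in a form that survives null factors. Each summand is a
    product over coordinates, to which [Rintegral_iid] applies. *)
Lemma xlnx_prod (R : realType) (I : finType) (F : I -> R) :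
  (forall i, 0 <= F i) ->
  xlnx (\prod_i F i) = \sum_i \prod_j (if j == i then xlnx (F j) else F j).
Proof.
move=> F0; have [/existsP[i0 /eqP Fi0]|/existsPn Fn0] := boolP [exists i, F i == 0].
  rewrite (bigD1 i0)//= Fi0 mul0r /xlnx mul0r big1// => i _.
  by rewrite (bigD1 i0)//=; case: ifP => _; rewrite Fi0 !mul0r.
have Fgt0 i : 0 < F i by rewrite lt0r Fn0 F0.
rewrite /xlnx ln_prod// mulr_sumr; apply: eq_bigr => i _.
rewrite (bigD1 i)//= [RHS](bigD1 i)//= eqxx.
rewrite [in RHS](eq_bigr F); last by move=> j /negPf ->.
by rewrite -!mulrA; congr (_ * _); rewrite mulrC.
Qed.

(** * Moments of check products under a likelihood *)

Section moments.
Context (d : measure_display) (Y : measurableType d) (R : realType).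
Variables (W : mbios Y R) (n : nat).
Local Notation soft := (soft_bit W).
Local Notation nu := (output_law W).
Local Notation Q := (iid nu n).
Implicit Types (x : 'I_n -> input) (v : n.-tuple Y) (A : {set 'I_n}).

Definition soft_moment p : R := \int[nu]_y (soft y ^+ p).

Lemma soft_moment_even_itv p : 0 <= soft_moment (2 * p) <= 1.
Proof.
have b p' := bounded_mfunX p' (bounded_soft W).
apply/andP; split; first by apply: Rintegral_ge0 => y _; exact: even_soft_ge0.
rewrite -[leRHS](probability_Rintegral_cst nu 1).
apply: bounded_le_Rintegral => //; first exact: bounded_mfun_cst.
by move=> y; rewrite (le_trans (ler_norm _))// normrX exprn_ile1// soft_le1.
Qed.

Lemma soft_moment_odd p : soft_moment (2 * p).+1 = 0.
Proof. by rewrite [LHS]Rintegral_soft_odd//= oddM. Qed.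

Lemma soft_moment0 : soft_moment 0 = 1.
Proof.
rewrite /soft_moment; under eq_Rintegral do rewrite expr0.
exact: probability_Rintegral_cst.
Qed.

Lemma Rintegral_signed_soft (s : input) p :
  \int[nu]_y ((1 + (-1) ^+ s * soft y) * soft y ^+ p) =
  soft_moment p + (-1) ^+ s * soft_moment p.+1.
Proof.
have b p' := bounded_mfunX p' (bounded_soft W).
transitivity (\int[nu]_y (soft y ^+ p + (-1) ^+ s * soft y ^+ p.+1)).
  by apply: eq_Rintegral => y _; rewrite exprS; ring.
by rewrite bounded_RintegralD ?bounded_RintegralZl//; exact: bounded_mfunZ.
Qed.

Lemma Rintegral_signed_soft1 (s : input) :
  \int[nu]_y (1 + (-1) ^+ s * soft y) = 1.
Proof.
have := Rintegral_signed_soft s 0.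
rewrite soft_moment0 (soft_moment_odd 0) mulr0 addr0 => E; rewrite -[RHS]E.
by apply: eq_Rintegral => y _; rewrite expr0 mulr1.
Qed.

(** The integrand factors over coordinates, and a coordinate outside [A] contributes the mean 1 of
    its likelihood factor. *)
Lemma Rintegral_likelihood_soft_prod x A p :
  \int[Q]_v (likelihood W x v * soft_prod W A v ^+ p) =
  \prod_(j in A) (soft_moment p + (-1) ^+ x j * soft_moment p.+1).
Proof.
pose h j y := (1 + (-1) ^+ x j * soft y) * (if j \in A then soft y ^+ p else 1).
have bh j : bounded_mfun (h j).
  apply: bounded_mfunM; first exact: bounded_signed_soft.
  by case: (j \in A); [exact/bounded_mfunX/bounded_soft|exact: bounded_mfun_cst].
transitivity (\int[Q]_v \prod_(j < n) h j (tnth v j)).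
  apply: eq_Rintegral => v _; rewrite big_split/=; congr (_ * _).
  by rewrite /soft_prod -prodrXl big_mkcond.
rewrite Rintegral_iid// [RHS]big_mkcond; apply: eq_bigr => j _.
rewrite /h; case: ifP => _; first exact: Rintegral_signed_soft.
by under eq_Rintegral do rewrite mulr1; exact: Rintegral_signed_soft1.
Qed.

Lemma Rintegral_likelihood_even x A p :
  \int[Q]_v (likelihood W x v * soft_prod W A v ^+ (2 * p)) = soft_moment (2 * p) ^+ #|A|.
Proof.
rewrite Rintegral_likelihood_soft_prod -prodr_const; apply: eq_bigr => j _.
by rewrite soft_moment_odd mulr0 addr0.
Qed.

(** The odd moment vanishes and leaves a sign times the next even moment at each coordinate. The
    signs multiply to 1, so the value is that of the next even power. *)
Lemma Rintegral_likelihood_odd x A p : \prod_(j in A) ((-1) ^+ x j : R) = 1 ->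
  \int[Q]_v (likelihood W x v * soft_prod W A v ^+ (2 * p).+1) =
  soft_moment (2 * p.+1) ^+ #|A|.
Proof.
move=> xA; rewrite Rintegral_likelihood_soft_prod soft_moment_odd.
under eq_bigr do rewrite add0r.
by rewrite big_split/= xA mul1r mulnS prodr_const.
Qed.

Lemma scaled_soft_prod_le lam A v : 0 <= lam -> `|lam * soft_prod W A v| <= lam.
Proof. by move=> lam0; rewrite normrM ger0_norm// ler_piMr// soft_prod_le1. Qed.

(** Taking [lam] below 1 keeps the argument of the logarithm away from 0. *)
Lemma bounded_ln_soft_prod lam A : 0 <= lam < 1 ->
  bounded_mfun (fun v => ln (1 + lam * soft_prod W A v)).
Proof.
move=> /andP[lam0 lam1]; split.
  apply: (measurableT_comp (@measurable_ln R)).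
  apply: measurable_funD => //; apply: measurable_funM => //.
  by have [] := bounded_soft_prod W A.
exists (ln 2 - ln (1 - lam)) => v.
have := scaled_soft_prod_le A v lam0; rewrite !ler_norml => /andP[t1 t2].
have l2 : 0 <= ln (2 : R) by rewrite ln_ge0// ler1n.
have l1 : ln (1 - lam) <= 0 by rewrite ln_le0//; lra.
have H1 : ln (1 - lam) <= ln (1 + lam * soft_prod W A v) by rewrite ler_ln ?posrE; lra.
have H2 : ln (1 + lam * soft_prod W A v) <= ln 2 by rewrite ler_ln ?posrE; lra.
by apply/andP; split; lra.
Qed.

(** The bound [ln_taylor_le] is integrated against the likelihood, each pair of consecutive powers
    having a common mean. *)
Lemma Rintegral_likelihood_ln_ge x A lam M : 0 < lam < 1 ->
  \prod_(j in A) ((-1) ^+ x j : R) = 1 ->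
  \sum_(p < M) soft_moment (2 * p.+1) ^+ #|A| *
    (lam ^+ (2 * p.+1) / ((2 * p).+1 * (2 * p).+2)%:R)
    - lam ^+ (2 * M) / (1 - lam)
  <= \int[Q]_v (likelihood W x v * ln (1 + lam * soft_prod W A v)).
Proof.
move=> /andP[lam0 lam1] xA.
have bL := bounded_likelihood W x; have bT p := bounded_mfunX p (bounded_soft_prod W A).
have bLT p : bounded_mfun (fun v => likelihood W x v * soft_prod W A v ^+ p).
  exact: bounded_mfunM.
pose a p := lam ^+ (2 * p).+1 / (2 * p).+1%:R.
pose b p := lam ^+ (2 * p).+2 / (2 * p).+2%:R.
pose K := lam ^+ (2 * M) / (1 - lam).
pose t p v := a p * (likelihood W x v * soft_prod W A v ^+ (2 * p).+1)
    - b p * (likelihood W x v * soft_prod W A v ^+ (2 * p).+2).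
have bt p : bounded_mfun (t p) by apply: bounded_mfunB; exact: bounded_mfunZ.
have bst : bounded_mfun (fun v => \sum_(p < M) t p v).
  by apply: bounded_mfun_sum => p.
apply: (@le_trans _ _ (\int[Q]_v (\sum_(p < M) t p v - K * likelihood W x v))).
  rewrite bounded_RintegralB//; last exact: bounded_mfunZ.
  rewrite bounded_RintegralZl// Rintegral_likelihood mulr1 lerB//.
  rewrite bounded_Rintegral_sum//; apply: ler_sum => p _.
  rewrite bounded_RintegralB ?bounded_RintegralZl//; [|exact: bounded_mfunZ..].
  rewrite Rintegral_likelihood_odd// -[(2 * p).+2](mulnS 2 p) Rintegral_likelihood_even.
  rewrite -mulrBl mulrC ler_wpM2r ?exprn_ge0//.
    by have /andP[] := soft_moment_even_itv p.+1.
  rewrite /a /b mulnS; set N : nat := (2 * p)%N.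
  (* Lowering the first power of [lam] to the second leaves the difference of reciprocals 1 / (N +
     1) - 1 / (N + 2), the reciprocal of the product. *)
  have l2 : lam ^+ N.+2 <= lam ^+ N.+1 by rewrite exprS ler_piMl ?exprn_ge0 ?ltW.
  apply: (@le_trans _ _ (lam ^+ N.+2 / N.+1%:R - lam ^+ N.+2 / N.+2%:R)).
    rewrite le_eqVlt; apply/orP; left; apply/eqP; rewrite natrM.
    rewrite -[N.+2%:R]natr1; field.
    by rewrite [1 + N%:R]addrC !natr1 !pnatr_eq0.
  by rewrite lerB// ler_wpM2r// invr_ge0.
apply: bounded_le_Rintegral.
- by apply: bounded_mfunB => //; exact: bounded_mfunZ.
- by apply: bounded_mfunM => //; apply: bounded_ln_soft_prod; rewrite ltW.
move=> v; have := ln_taylor_le M lam1 (scaled_soft_prod_le A v (ltW lam0)).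
move=> /(ler_wpM2l (likelihood_ge0 W x v)); apply: le_trans.
rewrite mulrBr [K * _]mulrC lerD2r /ln_taylor mulr_sumr; apply: ler_sum => p _.
by rewrite /t /a /b !exprMn le_eqVlt; apply/orP; left; apply/eqP; ring.
Qed.

Let xlnx_factor (x : 'I_n -> input) (i j : 'I_n) y : R :=
  if j == i then xlnx (1 + (-1) ^+ x j * soft y) else 1 + (-1) ^+ x j * soft y.

Let bounded_xlnx_factor x i j : bounded_mfun (xlnx_factor x i j).
Proof.
rewrite /xlnx_factor.
by case: eqP => _; [exact: bounded_xlnx_soft|exact: bounded_signed_soft].
Qed.

Let xlnx_likelihoodE x v : xlnx (likelihood W x v) =
  \sum_(i < n) \prod_(j < n) xlnx_factor x i j (tnth v j).
Proof.
rewrite xlnx_prod.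
  by apply: eq_bigr => i _; apply: eq_bigr => j _; rewrite /xlnx_factor; case: eqP.
by move=> j; have /andP[] := signed_soft_itv W (x j) (tnth v j).
Qed.

Let bounded_xlnx_term x i :
  bounded_mfun (fun v => \prod_(j < n) xlnx_factor x i j (tnth v j)).
Proof.
apply: bounded_mfun_prod => j.
exact: (bounded_mfun_tnth j (bounded_xlnx_factor x i j)).
Qed.

Lemma bounded_xlnx_likelihood x : bounded_mfun (fun v => xlnx (likelihood W x v)).
Proof.
by rewrite (funext (xlnx_likelihoodE x)); exact: bounded_mfun_sum.
Qed.

(** In each of the [n] summands one coordinate contributes the capacity in nats and the others
    contribute 1. *)
Lemma Rintegral_xlnx_likelihood x :
  \int[Q]_v xlnx (likelihood W x v) = n%:R * (capacity W * ln 2).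
Proof.
under eq_Rintegral do rewrite xlnx_likelihoodE.
rewrite bounded_Rintegral_sum//.
rewrite -[in RHS](card_ord n) -sum1_card natr_sum mulr_suml; apply: eq_bigr => i _.
rewrite mul1r Rintegral_iid// (bigD1 i)//= /xlnx_factor eqxx.
rewrite Rintegral_xlnx_soft_sym -capacityE big1 ?mulr1// => j /negPf ->.
exact: Rintegral_signed_soft1.
Qed.

End moments.

(** * Parity of the checks *)

Lemma F2_natr (b : 'F_2) : b = (b != 0)%:R.
Proof. by case: b => [[|[|]]]// ?; apply/val_inj. Qed.

Lemma F2_natr_odd p : (p%:R : 'F_2) = (odd p)%:R.
Proof.
have two0 : 2%:R = 0 :> 'F_2 by exact/val_inj.
by rewrite -[p in LHS]odd_double_half natrD -mul2n natrM two0 mul0r addr0.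
Qed.

Section parity.
Context (m n : nat) (H : 'M['F_2]_(m, n)).

Definition check_support i : {set 'I_n} := [set j | H i j != 0]%SET.

(** If every column met the rows of [J] an even number of times, these rows would sum to 0 over the
    field with two elements, against their independence. *)
Lemma row_free_odd_column (J : {set 'I_m}) : row_free H -> J != finset.set0 ->
  exists j, odd (\sum_(i in J) (j \in check_support i)).
Proof.
move=> Hfree; apply: contra_neqP => /forallNP even_col.
pose w : 'rV['F_2]_m := \row_i (i \in J)%:R.
have wH0 : w *m H = 0.
  apply/rowP => j; rewrite !mxE.
  transitivity (\sum_(i in J) ((j \in check_support i)%:R : 'F_2)).
    rewrite [RHS]big_mkcond; apply: eq_bigr => i _; rewrite mxE inE [H i j in LHS]F2_natr.
    by case: (i \in J); rewrite ?mul1r ?mul0r.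
  by rewrite -natr_sum F2_natr_odd; move: (even_col j) => /negP/negPf ->.
have w0 : w = 0 by apply: (row_free_inj Hfree); rewrite wH0 mul0mx.
apply/setP => i; rewrite inE; have := congr1 (fun u : 'rV_m => u 0 i) w0.
by rewrite !mxE; case: (i \in J) => // /eqP; rewrite oner_eq0.
Qed.

Lemma row_degreeE i : row_degree H i = #|check_support i|.
Proof. by apply: eq_card => j; rewrite !inE. Qed.

Lemma check_sign (R : pzRingType) (C : {vspace 'rV['F_2]_n}) c i :
  parity_check C H -> c \in C ->
  \prod_(j in check_support i) ((-1) ^+ modulate (c 0 j) : R) = 1.
Proof.
move=> HC; rewrite HC => /eqP/colP/(_ i); rewrite !mxE => s0.
have : ((\sum_(j in check_support i) modulate (c ord0 j))%N%:R : 'F_2) = 0.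
  rewrite natr_sum -[RHS]s0 big_mkcond; apply: eq_bigr => j _.
  rewrite inE mxE [H i j in RHS]F2_natr; case: (H i j != 0); rewrite ?mul0r//= mul1r.
  by rewrite [RHS]F2_natr.
rewrite F2_natr_odd => /eqP; case E: (odd _) => // _.
by rewrite -expr_sum -signr_odd E expr0.
Qed.

End parity.

(** * The mean of the product over the checks *)

Section check_product.
Context (d : measure_display) (Y : measurableType d) (R : realType).
Variables (W : mbios Y R) (m n : nat) (H : 'M['F_2]_(m, n)).
Local Notation soft := (soft_bit W).
Local Notation Q := (iid (output_law W) n).

Lemma bounded_check_prod lam :
  bounded_mfun (fun v => \prod_(i < m) (1 + lam * soft_prod W (check_support H i) v)).
Proof.
apply: bounded_mfun_prod => i; apply: bounded_mfunD; first exact: bounded_mfun_cst.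
exact/bounded_mfunZ/bounded_soft_prod.
Qed.

(* Expanding the product gives one monomial in the [soft (tnth v j)] per set of
   rows; a nonempty set of independent rows leaves some odd exponent, so that
   its monomial has mean [0]. *)
Lemma Rintegral_check_prod lam : row_free H ->
  \int[Q]_v \prod_(i < m) (1 + lam * soft_prod W (check_support H i) v) = 1.
Proof.
move=> Hfree; pose e (J : {set 'I_m}) j := (\sum_(i in J) (j \in check_support H i))%N.
have be J : bounded_mfun (fun v : n.-tuple Y => \prod_(j < n) soft (tnth v j) ^+ e J j).
  apply: bounded_mfun_prod => j.
  exact: (bounded_mfun_tnth j (bounded_mfunX (e J j) (bounded_soft W))).
transitivity (\int[Q]_v \sum_(J : {set 'I_m})
    lam ^+ #|J| * \prod_(j < n) soft (tnth v j) ^+ e J j).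
  apply: eq_Rintegral => v _; under eq_bigr do rewrite addrC.
  rewrite (bigA_distr 1 +%R (fun i => lam * soft_prod W (check_support H i) v)
    (fun=> 1)) (eq_bigl xpredT)//; apply: eq_bigr => J _.
  rewrite -big_mkcond big_split/= prodr_const; congr (_ * _).
  under [RHS]eq_bigr do rewrite -prodrXr.
  rewrite [RHS]exchange_big /=; apply: eq_bigr => i _.
  rewrite /soft_prod big_mkcond; apply: eq_bigr => j _.
  by case: (j \in _); rewrite ?expr1 ?expr0.
rewrite bounded_Rintegral_sum; last by move=> J; exact: bounded_mfunZ.
have IJ (J : {set 'I_m}) : \int[Q]_v (lam ^+ #|J| * \prod_(j < n) soft (tnth v j) ^+ e J j) =
    lam ^+ #|J| * \prod_(j < n) soft_moment W (e J j).
  rewrite bounded_RintegralZl// (@Rintegral_iid _ _ _ _ _ (fun j y => soft y ^+ e J j))//.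
  by move=> j; exact/bounded_mfunX/bounded_soft.
rewrite (bigD1 finset.set0)//= big1 => [|J J0].
  rewrite addr0 IJ cards0 mul1r big1// => j _.
  by rewrite /e big_set0 soft_moment0.
have [j oj] := row_free_odd_column Hfree J0.
by rewrite IJ (bigD1 j)//= [soft_moment _ _]Rintegral_soft_odd// mul0r mulr0.
Qed.

End check_product.

(** * Gibbs' inequality for the joint law of information and output *)

Lemma gibbs_pointwise (R : realType) (a b : R) : 0 <= a -> 0 < b ->
  a * ln b - xlnx a <= b - a.
Proof.
rewrite le_eqVlt => /predU1P[<-|a0] b0; first by rewrite /xlnx !mul0r !subr0 ltW.
have := ln_le_sub1 (divr_gt0 b0 a0).
rewrite ln_div ?posrE// -(ler_pM2l a0) /xlnx mulrBr => /le_trans; apply.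
by rewrite mulrBr mulr1 mulrCA divff ?mulr1// gt_eqF.
Qed.

(** This makes a guess that treats the information bits independently sum to 1 over all information
    vectors. *)
Lemma sum_rV_prod (R : comPzSemiRingType) (T : finType) k (c : 'I_k -> T -> R) :
  \sum_(u : 'rV[T]_k) \prod_(i < k) c i (u 0 i) = \prod_(i < k) \sum_(b : T) c i b.
Proof.
rewrite bigA_distr_bigA (reindex (fun f : {ffun 'I_k -> T} => \row_i f i)) /=.
  by apply: eq_bigr => f _; apply: eq_bigr => i _; rewrite mxE.
exists (fun u : 'rV_k => [ffun i => u 0 i]) => [f _|u _].
  by apply/ffunP => i; rewrite ffunE mxE.
by apply/rowP => i; rewrite mxE ffunE.
Qed.

Section gibbs.
Context (R : realType) (d d' : measure_display) (Y : measurableType d)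
  (W : mbios Y R) (n k : nat) (m : nat) (H : 'M['F_2]_(m, n)).
Context (enc : 'rV['F_2]_k -> 'rV['F_2]_n).
Context (Omega : measurableType d') (P : probability Omega R)
  (U : Omega -> 'rV['F_2]_k) (V : Omega -> n.-tuple Y)
  (dec : 'I_k -> n.-tuple Y -> 'F_2).
Hypotheses (H_free : row_free H)
  (H_sign : forall u i, \prod_(j in check_support H i)
     ((-1) ^+ modulate (enc u 0 j) : R) = 1)
  (UV : transmission P W enc U V) (dec_meas : measurable_decoder dec).
Local Notation Q := (iid (output_law W) n).

Let L u := likelihood W (fun j => modulate (enc u 0 j)).
Let Tc i := soft_prod W (check_support H i).
Let E i b : set (n.-tuple Y) := [set v | dec i v != b].

Definition bit_error i := fine (P [set w | dec i (V w) != U w 0 i]).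

Let mE i b : measurable (E i b).
Proof.
rewrite (_ : E i b = ~` [set v | dec i v = b]); first exact/measurableC.
by apply/seteqP; split => v /eqP.
Qed.

Let bL u : bounded_mfun (L u). Proof. exact: bounded_likelihood. Qed.

Let bE i b : bounded_mfun (\1_(E i b) : _ -> R).
Proof. exact: bounded_mfun_indic. Qed.

Let measurable_joint_error i u :
  measurable ([set w | U w = u] `&` V @^-1` E i (u 0 i)).
Proof.
have [mU _ mV _] := UV.
by apply: measurableI => //; rewrite -[X in measurable X]setTI; exact: mV.
Qed.

Let measurable_error i : measurable [set w | dec i (V w) != U w 0 i].
Proof.
rewrite (_ : [set w | _] =
  \big[setU/set0]_u ([set w | U w = u] `&` V @^-1` E i (u 0 i))).
  exact: bigsetU_measurable.
rewrite -bigcup_seq; apply/seteqP; split => w /=.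
  by move=> wE; exists (U w) => //=; rewrite mem_index_enum.
by move=> [u _ [/= <-]].
Qed.

Lemma bit_error_itv i : 0 <= bit_error i <= 1.
Proof.
rewrite fine_ge0//= -lee_fin fineK ?fin_num_measure//.
by apply: probability_le1; exact: measurable_error.
Qed.

(** The error event splits according to the value of [U], and [joint_law] gives each piece the
    weight 2 to the power -k. *)
Lemma sum_Rintegral_error i :
  \sum_(u : 'rV['F_2]_k) \int[Q]_v (L u v * \1_(E i (u 0 i)) v) =
  2 ^+ k * bit_error i.
Proof.
have -> : bit_error i = \sum_(u : 'rV['F_2]_k)
    fine (P ([set w | U w = u] `&` V @^-1` E i (u 0 i))).
  under eq_bigr do rewrite -Rintegral_indic_probability//.
  rewrite -bounded_Rintegral_sum; last by move=> u; exact: bounded_mfun_indic.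
  rewrite /bit_error -Rintegral_indic_probability//.
  apply: eq_Rintegral => w _; rewrite (bigD1 (U w))//= big1 ?addr0.
    rewrite !indicE; congr (nat_of_bool _)%:R.
    by apply/idP/idP; rewrite !inE => //= -[].
  move=> u uU; rewrite indicE memNset// => -[/= Uu _].
  by rewrite Uu eqxx in uU.
rewrite mulr_sumr; apply: eq_bigr => u _.
rewrite (joint_law u UV (mE i (u 0 i))) mulVKf ?expf_neq0//.
by apply: eq_Rintegral => v _; rewrite mulrC.
Qed.

(** Apply [gibbs_pointwise] with the likelihood [L u] as [a] and the scaled guess [B u] as [b].
    Summed over [u] and integrated, the two have equal mass, so the right side vanishes. *)
Lemma gibbs_inequality (eps lam : R) M : 0 < eps < 1 -> 0 < lam < 1 ->
  k%:R * ln 2 + k%:R * ln (1 - eps)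
  + (\sum_(i < k) bit_error i) * (ln eps - ln (1 - eps))
  + \sum_(i < m) (\sum_(p < M) soft_moment W (2 * p.+1) ^+ #|check_support H i| *
      (lam ^+ (2 * p.+1) / ((2 * p).+1 * (2 * p).+2)%:R)
      - lam ^+ (2 * M) / (1 - lam))
  <= n%:R * (capacity W * ln 2).
Proof.
move=> /andP[eps0 eps1] lam01; have /andP[lam0 lam1] := lam01.
pose D := ln eps - ln (1 - eps).
(* The guessed probability that bit [i] is [b]: [1 - eps] for the decided value and [eps] for the
   other. It is affine in an indicator, and so is its logarithm [lrf]. *)
pose rf i b v : R := 1 - eps + (eps - (1 - eps)) * \1_(E i b) v.
pose lrf i b v : R := ln (1 - eps) + D * \1_(E i b) v.
have rf_gt0 i b v : 0 < rf i b v.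
  by rewrite /rf indicE; case: (_ \in _); rewrite ?mulr1 ?mulr0; lra.
have lrfE i b v : ln (rf i b v) = lrf i b v.
  rewrite /rf /lrf /D indicE; case: (_ \in _); rewrite ?mulr1 ?mulr0 ?addr0//.
  by rewrite !subrKC.
have brf i b : bounded_mfun (rf i b).
  by apply: bounded_mfunD; [exact: bounded_mfun_cst|exact: bounded_mfunZ].
have blrf i b : bounded_mfun (lrf i b).
  by apply: bounded_mfunD; [exact: bounded_mfun_cst|exact: bounded_mfunZ].
pose r (u : 'rV['F_2]_k) v := \prod_(i < k) rf i (u 0 i) v.
pose F v := \prod_(i < m) (1 + lam * Tc i v).
have r_gt0 u v : 0 < r u v by exact: prodr_gt0.
have F1_gt0 i v : 0 < 1 + lam * Tc i v.
  have := scaled_soft_prod_le W (check_support H i) v (ltW lam0).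
  by rewrite ler_norml /Tc => /andP[? ?]; lra.
have F_gt0 v : 0 < F v by exact: prodr_gt0.
have sum_r v : \sum_u r u v = 1.
  rewrite (@sum_rV_prod _ _ _ (fun i b => rf i b v)) big1// => i _.
  rewrite (bigD1 (dec i v))//= (bigD1 (dec i v + 1))/=; last first.
    by rewrite -subr_eq0 addrAC subrr add0r oner_eq0.
  rewrite big1 ?addr0 => [|b /andP[b0 b1]]; last first.
    move: b0 b1; case: (dec i v) => [[|[|]]]//; case: b => [[|[|]]]//.
  rewrite /rf !indicE memNset; last by rewrite /E /= eqxx.
  rewrite mem_set; last by rewrite /E /= eq_sym -subr_eq0 addrAC subrr add0r oner_eq0.
  by rewrite mulr0 mulr1; ring.
(* The factor [2 ^+ k] compensates for the uniform weight of the information vector, which [L u]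
   omits. *)
pose B u v := 2 ^+ k * (r u v * F v).
have B_gt0 u v : 0 < B u v by rewrite mulr_gt0 ?exprn_gt0// mulr_gt0.
have br u : bounded_mfun (r u) by exact: bounded_mfun_prod.
have bF : bounded_mfun F by exact: bounded_check_prod.
have brF u : bounded_mfun (fun v => r u v * F v) by exact: bounded_mfunM.
have bB u : bounded_mfun (B u) by exact: bounded_mfunZ.
have blT i : bounded_mfun (fun v => ln (1 + lam * Tc i v)).
  by apply: bounded_ln_soft_prod; rewrite ltW.
have bLlr u i : bounded_mfun (fun v => L u v * lrf i (u 0 i) v) by exact: bounded_mfunM.
have bLlT u i : bounded_mfun (fun v => L u v * ln (1 + lam * Tc i v)).
  exact: bounded_mfunM.
have bxL u : bounded_mfun (fun v => xlnx (L u v)) by exact: bounded_xlnx_likelihood.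
have bLE u i : bounded_mfun (fun v => L u v * \1_(E i (u 0 i)) v) by exact: bounded_mfunM.
have intL u : \int[Q]_v L u v = 1 by exact: Rintegral_likelihood.
have lnBE u v : ln (B u v) =
    k%:R * ln 2 + \sum_(i < k) lrf i (u 0 i) v + \sum_(i < m) ln (1 + lam * Tc i v).
  rewrite lnM ?posrE ?exprn_gt0 ?mulr_gt0// lnM ?posrE// lnXn// -[_ *+ k]mulr_natl addrA.
  by rewrite !ln_prod//; under eq_bigr do rewrite lrfE.
(* The Gibbs integrand with the logarithm of [B u v] expanded, so that each term can be integrated
   separately. *)
pose G u v := k%:R * ln 2 * L u v + \sum_(i < k) L u v * lrf i (u 0 i) v
  + \sum_(i < m) L u v * ln (1 + lam * Tc i v) - xlnx (L u v).
have GE u v : G u v = L u v * ln (B u v) - xlnx (L u v).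
  by rewrite lnBE /G !mulrDr !mulr_sumr [_ * L u v]mulrC.
have bG u : bounded_mfun (G u).
  apply: bounded_mfunB => //; apply: bounded_mfunD; last exact: bounded_mfun_sum.
  by apply: bounded_mfunD; [exact: bounded_mfunZ|exact: bounded_mfun_sum].
pose S i := \sum_(p < M) soft_moment W (2 * p.+1) ^+ #|check_support H i| *
  (lam ^+ (2 * p.+1) / ((2 * p).+1 * (2 * p).+2)%:R) - lam ^+ (2 * M) / (1 - lam).
have intG u : k%:R * ln 2 + k%:R * ln (1 - eps)
    + (\sum_(i < k) \int[Q]_v (L u v * \1_(E i (u 0 i)) v)) * D
    + \sum_(i < m) S i - n%:R * (capacity W * ln 2) <= \int[Q]_v G u v.
  have b1 : bounded_mfun (fun v => k%:R * ln 2 * L u v) by exact: bounded_mfunZ.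
  have b2 : bounded_mfun (fun v => \sum_(i < k) L u v * lrf i (u 0 i) v).
    exact: bounded_mfun_sum.
  have b3 : bounded_mfun (fun v => \sum_(i < m) L u v * ln (1 + lam * Tc i v)).
    exact: bounded_mfun_sum.
  have b12 := bounded_mfunD b1 b2.
  rewrite bounded_RintegralB//; last exact: (bounded_mfunD b12 b3).
  rewrite bounded_RintegralD// bounded_RintegralD// bounded_RintegralZl//.
  rewrite intL mulr1 !bounded_Rintegral_sum// Rintegral_xlnx_likelihood lerD2r.
  apply: lerD; last by apply: ler_sum => i _; exact: Rintegral_likelihood_ln_ge.
  rewrite -addrA lerD2l le_eqVlt; apply/orP; left; apply/eqP.
  transitivity (\sum_(i < k) (ln (1 - eps) +
      (\int[Q]_v (L u v * \1_(E i (u 0 i)) v)) * D)).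
    by rewrite big_split/= sumr_const card_ord mulr_natl mulr_suml.
  apply: eq_bigr => i _.
  transitivity (ln (1 - eps) * \int[Q]_v L u v +
      D * \int[Q]_v (L u v * \1_(E i (u 0 i)) v)); first by rewrite intL; ring.
  rewrite -!bounded_RintegralZl// -bounded_RintegralD//; [|exact: bounded_mfunZ..].
  by apply: eq_Rintegral => v _; rewrite /lrf; ring.
(* The guesses sum to 1 and leave the check product, of mean 1; hence both parts total [2 ^+ k]. *)
have sumB : \sum_u \int[Q]_v (B u v - L u v) = 0.
  under eq_bigr do rewrite bounded_RintegralB// intL bounded_RintegralZl//.
  rewrite big_split/= -mulr_sumr -bounded_Rintegral_sum//.
  under eq_Rintegral do rewrite -mulr_suml sum_r mul1r.
  rewrite Rintegral_check_prod// mulr1 sumr_const card_mx mul1n card_Fp//.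
  by rewrite mulNrn natrX subrr.
have : \sum_u \int[Q]_v G u v <= 0.
  rewrite -[leRHS]sumB; apply: ler_sum => u _; apply: bounded_le_Rintegral => //.
    exact: bounded_mfunB.
  by move=> v; rewrite GE; apply: gibbs_pointwise => //; exact: likelihood_ge0.
have sum_cst (c : R) : \sum_(u : 'rV['F_2]_k) c = 2 ^+ k * c.
  by rewrite sumr_const card_mx mul1n card_Fp// mulrC -natrX mulr_natr.
move=> /(le_trans (ler_sum _ (fun u _ => intG u))).
rewrite !big_split/= !sum_cst -mulr_suml exchange_big/=.
under [X in X * D]eq_bigr do rewrite sum_Rintegral_error.
by rewrite -mulr_sumr -mulrA -!mulrDr pmulr_rle0 ?exprn_gt0// subr_le0.
Qed.

End gibbs.

(** * Optimizing the guess, letting [lam] tend to 1, and assembling the bound *)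

Lemma le_binary_entropy (R : realType) (x p : R) : 0 <= p <= 1 ->
  (forall eps, 0 < eps < 1 -> x <= - p * ln eps - (1 - p) * ln (1 - eps)) ->
  x <= - p * ln p - (1 - p) * ln (1 - p).
Proof.
(* In the interior the choice [eps = p] gives the entropy. *)
move=> /andP[p0 p1] H; have [p01|] := boolP (0 < p < 1); first exact: H.
rewrite !lt_neqAle p0 p1 !andbT negb_and !negbK => p01.
(* At an endpoint [eps = p] is excluded. If [x] were positive, an [eps] within [t] of that
   endpoint's opposite choice, normalized so that the bound equals x / 2, would give x <= x / 2. *)
have edge : x <= 0.
  rewrite leNgt; apply/negP => x0; pose t := expR (- (x / 2)).
  have t01 : 0 < t < 1 by rewrite expR_gt0 /t expR_lt1; lra.
  case/orP: p01 => /eqP pE.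
  - have /H : 0 < 1 - t < 1 by lra.
    by rewrite -pE subKr /t expRK; lra.
  - by have := H t t01; rewrite pE /t expRK; lra.
by case/orP: p01 => /eqP pE; [rewrite -pE|rewrite pE]; rewrite ?subr0 ?subrr ?ln1 ?ln0//; lra.
Qed.

(** An Abel summation argument: for fixed [lam] the error term vanishes as [M] grows, and only then
    does [lam] tend to 1 from the left. Nonnegative terms allow truncation at [N]. *)
Lemma abel_sum_le (R : realType) (b : nat -> R) (c z : R) :
  (forall p, 0 <= b p) ->
  (forall lam M, 0 < lam < 1 ->
    \sum_(p < M) b p * lam ^+ (2 * p.+1) - c * (lam ^+ (2 * M) / (1 - lam)) <= z) ->
  forall N, \sum_(p < N) b p <= z.
Proof.
move=> b0 H N.
pose s := \sum_(p < N) b p.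
have s0 : 0 <= s by exact: sumr_ge0.
have step lam : 0 < lam < 1 -> lam ^+ (2 * N) * s <= z.
  move=> lam01; have /andP[lam0 lam1] := lam01.
  have cvg0 : (fun M => z + c * (lam ^+ (2 * M) / (1 - lam))) @ \oo --> z.
    rewrite -[X in _ --> X]addr0; apply: cvgD; first exact: cvg_cst.
    rewrite -[X in _ --> X](mulr0 c); apply: cvgM; first exact: cvg_cst.
    rewrite -[X in _ --> X](mul0r (1 - lam)^-1); apply: cvgM; last exact: cvg_cst.
    under eq_fun do rewrite exprM; apply: cvg_expr.
    by rewrite ger0_norm ?sqr_ge0// expr_lt1// ltW.
  apply: (cvgr_to_ge cvg0); exists N => // M /= NM.
  rewrite -lerBlDr (le_trans _ (H lam M lam01))// lerD2r mulr_sumr.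
  rewrite -(subnK NM) addnC big_split_ord /= -[leLHS]addr0 lerD//; last first.
    by apply: sumr_ge0 => p _; rewrite mulr_ge0// exprn_ge0// ltW.
  (* Since p + 1 is at most [N], each retained power of [lam] is at least [lam ^+ (2 * N)]. *)
  apply: ler_sum => p _; rewrite mulrC ler_wpM2l// ler_wiXn2l// ?ltW//.
  by rewrite leq_mul2l /= ltn_ord.
have cvg1 : lam ^+ (2 * N) * s @[lam --> 1^'-] --> s.
  rewrite -[X in _ --> X]mul1r -[1 in X in _ --> X](expr1n R (2 * N)).
  apply: cvgM; last exact: cvg_cst.
  by apply: cvg_at_left_filter; exact: exprn_continuous.
apply: (cvgr_to_le cvg1); near=> lam; apply: step; apply/andP; split.
  by near: lam; exact: nbhs_left_gt.
by near: lam; exact: nbhs_left_lt.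
Unshelve. all: by end_near.
Qed.

(** Rank-nullity: the code is the kernel of multiplication by the transpose of [H], which is onto
    because the rows of [H] are independent. *)
Lemma dim_row_free_code (m n : nat) (C : {vspace 'rV['F_2]_n})
    (H : 'M['F_2]_(m, n)) :
  row_free H -> parity_check C H -> (\dim C + m)%N = n.
Proof.
move=> Hfree HC; pose f : 'Hom('rV['F_2]_n, 'rV['F_2]_m) := linfun (mulmxr H^T).
have fE c : f c = c *m H^T by rewrite lfunE.
have -> : C = lker f.
  by apply/vspaceP => c; rewrite HC memv_ker fE -trmx_eq0 trmx_mul trmxK.
have dimf : \dim (limg f) = m.
  suff -> : limg f = fullv by rewrite dimvf dim_matrix mul1r.
  apply/eqP; rewrite eqEsubv subvf; apply/subvP => y _.
  have fullHT : row_full H^T by rewrite /row_full mxrank_tr.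
  have /submxP[w ->] := submx_full y fullHT.
  by rewrite -fE memv_img ?memvf.
have dimn : \dim (fullv : {vspace 'rV['F_2]_n}) = n by rewrite dimvf dim_matrix mul1r.
by rewrite -[RHS]dimn -(limg_ker_dim f fullv) capfv dimf.
Qed.

(** Grouping the rows by degree turns the sum over checks produced by Gibbs' inequality into
    [Gamma]. *)
Lemma horner_Gamma (R : realType) (m n : nat) (H : 'M['F_2]_(m, n)) (g : R) :
  m%:R * (Gamma R H).[g] = \sum_(i < m) g ^+ #|check_support H i|.
Proof.
have [m0|m_gt0] := posnP m.
  rewrite (_ : m%:R = 0 :> R) ?m0// mul0r big1// => i _.
  by move: (ltn_ord i); rewrite [X in (_ < X)%N]m0.
rewrite /Gamma horner_poly mulr_sumr.
have degP (i : 'I_m) : (row_degree H i < n.+1)%N.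
  by rewrite ltnS -[X in (_ <= X)%N](card_ord n) max_card.
rewrite (partition_big (fun i => Ordinal (degP i)) xpredT)//=.
apply: eq_bigr => k _; rewrite mulrA mulrCA divff ?pnatr_eq0 -?lt0n// mulr1.
rewrite (eq_bigr (fun=> g ^+ k)); last first.
  by move=> i /eqP <- /=; rewrite row_degreeE.
by rewrite sumr_const mulr_natl; congr (_ *+ _); apply: eq_card => i; rewrite !inE.
Qed.

Lemma Gamma_ge0 (R : realType) (m n : nat) (H : 'M['F_2]_(m, n)) (g : R) :
  0 <= g -> 0 <= (Gamma R H).[g].
Proof.
move=> g0; rewrite /Gamma horner_poly; apply: sumr_ge0 => k _.
by rewrite mulr_ge0 ?exprn_ge0// divr_ge0.
Qed.

Theorem corollary2p2 (R : realType) (d d' : measure_display)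
    (Y : measurableType d) (W : mbios Y R)
    (n : nat) (C : {vspace 'rV['F_2]_n}) (C_gt0 : 0 < rate R C)
    (m : nat) (H : 'M['F_2]_(m, n))
    (H_full : row_free H) (H_C : parity_check C H)
    (enc : 'Hom('rV['F_2]_(\dim C), 'rV['F_2]_n)) (enc_C : encoder enc)
    (Omega : measurableType d') (P : probability Omega R)
    (U : Omega -> 'rV['F_2]_(\dim C)) (V : Omega -> n.-tuple Y)
    (UV : transmission P W enc U V)
    (dec : 'I_(\dim C) -> n.-tuple Y -> 'F_2)
    (dec_meas : measurable_decoder dec) :
  ((1 - capacity W / rate R C)%:E +
   ((1 - rate R C) / (2 * rate R C * ln 2))%:E *
     \sum_(1 <= p <oo) ((Gamma R H).[g_ W p] / (p * (2 * p - 1))%:R)%:E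
   <= (h2 (bit_error_probability P U V dec))%:E)%E.
Proof.
set k := \dim C in enc enc_C U UV dec dec_meas *.
have k0 : 0 < k%:R :> R.
  rewrite lt0r ler0n andbT; apply: contraTneq C_gt0 => kR0.
  by rewrite /rate -/k kR0 mul0r ltxx.
have n0 : 0 < n%:R :> R.
  rewrite lt0r ler0n andbT; apply: contraTneq C_gt0 => nR0.
  by rewrite /rate nR0 invr0 mulr0 ltxx.
have kmn : k%:R + m%:R = n%:R :> R by rewrite -natrD (dim_row_free_code H_full H_C).
have l2 : 0 < ln 2 :> R by rewrite ln_gt0// ltr1n.
have H_sign u i : \prod_(j in check_support H i)
    ((-1) ^+ modulate (enc u 0 j) : R) = 1.
  by apply: (check_sign _ _ H_C); have [_ <-] := enc_C; rewrite memv_img ?memvf.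
have gE p : g_ W p.+1 = soft_moment W (2 * p.+1) by exact: g_E.
have g0 p : 0 <= g_ W p.+1 by rewrite gE; have /andP[] := soft_moment_even_itv W p.+1.
set pb := bit_error_probability P U V dec.
have pbE : k%:R * pb = \sum_(i < k) bit_error P U V dec i.
  by rewrite /pb /bit_error_probability mulrC divfK// gt_eqF.
have pb01 : 0 <= pb <= 1.
  have be i : 0 <= bit_error P U V dec i <= 1 by exact: bit_error_itv UV dec_meas i.
  apply/andP; split.
    rewrite -(pmulr_rge0 _ k0) pbE; apply: sumr_ge0 => i _.
    by have /andP[] := be i.
  rewrite -(ler_pM2l k0) pbE mulr1 -[k in leRHS]card_ord -sumr_const.
  by apply: ler_sum => i _; have /andP[] := be i.
(* Up to the factor [k%:R * ln 2], this is term p + 1 of the series with its constant: for q = p + 1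
   the denominator is 2 q (2 q - 1). *)
pose b p := m%:R * (Gamma R H).[g_ W p.+1] / ((2 * p).+1 * (2 * p).+2)%:R.
have b0 p : 0 <= b p by rewrite divr_ge0// mulr_ge0// Gamma_ge0.
have partial N : \sum_(p < N) b p <=
    n%:R * (capacity W * ln 2) - k%:R * ln 2 + k%:R * (h2 pb * ln 2).
  apply: (@abel_sum_le _ b m%:R) => // lam M lam01.
  set K := lam ^+ (2 * M) / (1 - lam).
  pose S := \sum_(p < M) b p * lam ^+ (2 * p.+1) - m%:R * K.
  have := @le_binary_entropy _ ((k%:R * ln 2 + S - n%:R * (capacity W * ln 2)) / k%:R) _ pb01.
  rewrite -/S; have -> : - pb * ln pb - (1 - pb) * ln (1 - pb) = h2 pb * ln 2.
    by rewrite /h2 /log2; field; rewrite gt_eqF.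
  rewrite ler_pdivrMr// => Hent; suff /Hent : forall eps, 0 < eps < 1 ->
      (k%:R * ln 2 + S - n%:R * (capacity W * ln 2)) / k%:R <=
      - pb * ln eps - (1 - pb) * ln (1 - eps) by lra.
  move=> eps eps01; rewrite ler_pdivrMr//.
  have := @gibbs_inequality _ _ _ _ W n k m H enc _ P U V dec H_full H_sign UV
    dec_meas eps lam M eps01 lam01.
  rewrite -pbE sumrB sumr_const card_ord -/K -mulr_natl exchange_big /=.
  have -> : \sum_(p < M) \sum_(i < m) soft_moment W (2 * p.+1) ^+ #|check_support H i| *
      (lam ^+ (2 * p.+1) / ((2 * p).+1 * (2 * p).+2)%:R) = S + m%:R * K.
    rewrite /S subrK; apply: eq_bigr => p _.
    by rewrite -mulr_suml -horner_Gamma -gE /b mulrA mulrAC.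
  lra.
set t := fun p => (Gamma R H).[g_ W p] / (p * (2 * p - 1))%:R.
have t0 p : 0 <= t p.
  (* The index 0 lies outside the series; there the denominator is 0 and the quotient is 0 by
     convention. *)
  case: p => [|p]; first by rewrite /t mul0n invr0 mulr0.
  by rewrite divr_ge0// Gamma_ge0.
set c := (1 - rate R C) / (2 * rate R C * ln 2); set a := 1 - _.
have tb p : c * t p.+1 = b p / (k%:R * ln 2).
  rewrite /c /t /b /rate -/k (_ : 2 * p.+1 - 1 = (2 * p).+1)%N; last first.
    by rewrite mulnS subn1.
  rewrite -[(2 * p).+2](mulnS 2 p) !natrM -kmn.
  have nz : k%:R + m%:R != 0 :> R by rewrite kmn gt_eqF.
  field.
  by rewrite nz [1 + p%:R]addrC [1 + 2 * _]addrC -natrM !natr1 (gt_eqF l2) (gt_eqF k0) !pnatr_eq0.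
have c0 : 0 <= c.
  rewrite divr_ge0 ?mulr_ge0 ?(ltW l2) ?(ltW C_gt0)//.
  by rewrite subr_ge0 ler_pdivrMr// mul1r -kmn lerDl.
have := @nneseriesZl R (fun p => (t p)%:E) xpredT c 1 (fun p _ => t0 p).
move=> <-.
apply: (@le_trans _ _ (a%:E + (h2 pb - a)%:E)%E); last by rewrite -EFinD subrKC.
rewrite leeD2l//; apply: lime_le.
  by apply: is_cvg_nneseries => p _ _; rewrite -EFinM lee_fin mulr_ge0.
(* The series starts at 1, so its partial sum below N + 1 has the [N] terms bounded by [partial]. *)
exists 1%N => // -[//|N] _ /=.
under eq_bigr do rewrite -EFinM.
rewrite sumEFin lee_fin big_add1 /= big_mkord.
under eq_bigr do rewrite tb.
rewrite -mulr_suml ler_pdivrMr ?mulr_gt0// (le_trans (partial N))//.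
rewrite le_eqVlt; apply/orP; left; apply/eqP.
rewrite /a /rate -/k; field.
by rewrite !gt_eqF.
Qed.
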